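(* Let $X$ and $Y$ be $c$-quasiconvex and complete metric spaces, and let $f:G\to G'$ be a weakly $H$-quasisymmetric homeomorphism between two domains $G\subsetneq X$ and $G'\subsetneq Y$. Suppose that $G'$ is $b$-uniform. Then there are constants $\lambda_1,\lambda_2$ depending only on $c$, $H$ and $b$ such that for every $\varepsilon$-short arc $\gamma$ in $G$ with endpoints $x$ and $y$, where $0<\varepsilon<\min\{1,\frac{k_G(x,y)}{6}\}$, the image $\gamma'=f(\gamma)$ satisfies (1) $\min\{\operatorname{diam}(\gamma'[f(x),f(u)]),\operatorname{diam}(\gamma'[f(y),f(u)])\}\le \lambda_1\,\delta_{G'}(f(u))$ for all $u\in\gamma$; (2) $\operatorname{diam}(\gamma')\le\lambda_2|f(x)-f(y)|$.
   Context: All distances are written $|x-y|$. No local compactness is assumed. A domain is a nonempty open connected subset. A metric space $X$ is $c$-quasiconvex ($c\ge1$) if each pair of points $x,y\in X$ can be joined by an arc $\gamma$ in $X$ with length $\ell(\gamma)\le c|x-y|$. A homeomorphism $f:G\to G'$ is weakly $H$-quasisymmetric if $|x-a|\le |x-b|$ implies $|f(x)-f(a)|\le H|f(x)-f(b)|$ for each triple $x,a,b$ of points in $G$. For a domain $G\subsetneq X$, $\delta_G(z)$ is the distance from $z\in G$ to the boundary $\partial G$ of $G$ in $X$ (for $G'\subsetneq Y$, boundary in $Y$). The domain $G$ is $b$-uniform if each pair of points $x,y\in G$ can be joined by a rectifiable arc $\gamma$ in $G$ such that $\min\{\ell(\gamma[x,z]),\ell(\gamma[z,y])\}\le b\,\delta_G(z)$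 for all $z\in\gamma$, and $\ell(\gamma)\le b|x-y|$. Here $\gamma[x,z]$ denotes the part of $\gamma$ between $x$ and $z$. The quasihyperbolic length of a rectifiable arc $\gamma\subset G$ is $\ell_{k_G}(\gamma)=\int_\gamma\frac{|dz|}{\delta_G(z)}$, and the quasihyperbolic distance is $k_G(x,y)=\inf\ell_{k_G}(\gamma)$, the infimum over all rectifiable arcs $\gamma$ joining $x$ to $y$ in $G$. An arc $\gamma\subset G$ with endpoints $x,y$ is $\varepsilon$-short ($\varepsilon\ge0$) if $\ell_{k_G}(\gamma)\le k_G(x,y)+\varepsilon$. *)

(* Defs.v *)
Set Warnings "-notation-incompatible-prefix,-notation-overridden".
From HB Require Import structures.
From mathcomp Require Export all_boot all_order all_algebra.
From mathcomp Require Export all_classical all_reals all_analysis.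

Set Implicit Arguments.
Unset Strict Implicit.
Unset Printing Implicit Defensive.

Export Order.TTheory GRing.Theory Num.Theory.
Export numFieldNormedType.Exports.

Local Open Scope classical_set_scope.
Local Open Scope ring_scope.

#[short(type="completeMetricType")]
HB.structure Definition CompleteMetric (R : numDomainType) :=
  {T of Complete T & Metric R T}.

Section metric.
Context {R : realType} {X : metricType R}.
Implicit Types (A G : set X) (x y z : X) (g : R -> X) (a b c s t : R).

(* Valued in the extended reals, so that an unbounded set has diameter +oo. *)
Definition diam A : \bar R :=
  ereal_sup [set (mdist p.1 p.2)%:E | p in A `*` A].

Definition boundary A : set X := closure A `\` interior A.

(* Only meaningful when the boundary is nonempty, as it is for a proper
   domain of a connected space. *)
Definition bdist G z : R := inf [set mdist z w | w in boundary G].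

Definition domain G := [/\ G !=set0, open G & connected G].

(* The arc is the set [g @` `[a, b]]. The one-point arc a = b is allowed: it
   joins a point to itself. *)
Definition arc a b g := [/\ a <= b, {within `[a, b], continuous g} &
  {in `[a, b] &, injective g}].

Definition arc_joins a b g x y := [/\ arc a b g, g a = x & g b = y].

Definition curve_sum a b g (p : seq R) : R :=
  let F := g \o nth b (a :: p) in \sum_(0 <= n < size p) mdist (F n) (F n.+1).

Definition curve_length a b g : \bar R :=
  ereal_sup [set (curve_sum a b g p)%:E | p in itv_partition a b].

Definition rectifiable a b g := (curve_length a b g < +oo)%E.

Definition quasiconvex c := forall x y, exists a b g,
  arc_joins a b g x y /\ (curve_length a b g <= (c * mdist x y)%:E)%E.

Definition uniform_domain (b : R) G := forall x y, G x -> G y ->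
  exists t0 t1 g, [/\ arc_joins t0 t1 g x y /\ g @` `[t0, t1] `<=` G,
    rectifiable t0 t1 g,
    forall t, t \in `[t0, t1] ->
      (mine (curve_length t0 t g) (curve_length t t1 g)
         <= (b * bdist G (g t))%:E)%E &
    (curve_length t0 t1 g <= (b * mdist x y)%:E)%E].

(* The point of the arc at length s from g a; the parameter t is unique when
   g is an arc, and exists for 0 <= s <= curve_length a b g when the arc is
   rectifiable. *)
Definition arclength_param a b g s : X :=
  g (xget a [set t | t \in `[a, b] /\ curve_length a t g = s%:E]).

(* Integral of rho against arc length; only meaningful for rectifiable arcs. *)
Definition line_integral (rho : X -> R) a b g : \bar R :=
  (\int[lebesgue_measure]_(s in `[0%R, fine (curve_length a b g)])
     (rho (arclength_param a b g s))%:E)%E.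

Definition qh_length G a b g : \bar R :=
  line_integral (fun z => (bdist G z)^-1) a b g.

Definition qh_dist G x y : \bar R := ereal_inf
  [set l | exists a b g, [/\ arc_joins a b g x y, g @` `[a, b] `<=` G,
     rectifiable a b g & l = qh_length G a b g]].

Definition short_arc G (eps : R) a b g x y :=
  [/\ arc_joins a b g x y, g @` `[a, b] `<=` G, rectifiable a b g &
      (qh_length G a b g <= qh_dist G x y + eps%:E)%E].

End metric.

Section maps.
Context {R : realType} {X Y : metricType R}.
Implicit Types (f : X -> Y) (G : set X).

(* The values of f and h outside G and G' are irrelevant. *)
Definition homeomorphism_on G (G' : set Y) f := [/\ set_bij G G' f,
  {within G, continuous f} &
  exists2 h : Y -> X, {within G', continuous h} &
    forall x, G x -> h (f x) = x].

Definition weakly_quasisymmetric (H : R) G f := forall x a b,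
  G x -> G a -> G b -> mdist x a <= mdist x b ->
  mdist (f x) (f a) <= H * mdist (f x) (f b).

End maps.

Arguments quasiconvex {R} X c.

(* Main.v *)
Require Import Defs.
From mathcomp Require Import measurable_realfun.
From mathcomp Require Import ring lra.

(** The image of a weakly quasisymmetric map f is compared with the
    quasihyperbolic metric k of G by two local estimates.  If |u - v| is at most
    delta(u) / 4c then |f u - f v| <= 3 H delta'(f u); if |f u - f v| is a small
    multiple of delta'(f u) then |u - v| <= delta(u) / 4c, hence k(u, v) <= 1.
    Both are proved by chaining the weak quasisymmetry condition along a curve
    to the boundary and by completeness of X and Y.  Cutting a uniform arc of G'
    at points of geometrically increasing distance to its endpoints, the second
    estimate bounds k(u, v) by a logarithm of
    |f u - f v| / min (delta'(f u), delta'(f v)); cutting a short arc along balls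
    B(u, delta(u) / 4c), the first one bounds the size of an image subarc
    linearly in k.  As a logarithm is beaten by a linear function, a subarc of
    the image at whose endpoints delta' is at least s, and on which delta' is at
    most A s, has size at most a constant times s.  Summing this over subarcs on
    which delta' grows geometrically gives (1), and then (2), except when
    |f x - f y| is small compared with delta'(f x): in that case the bound
    eps < k(x, y) / 6 keeps the arc in a ball of radius 4 c |x - y|. *)

Set Implicit Arguments.
Unset Strict Implicit.
Unset Printing Implicit Defensive.

Local Open Scope classical_set_scope.
Local Open Scope ring_scope.

(** * Continuous curves and their length *)

Section continuity.
Context {R : realType}.

(** Without local compactness, quasihyperbolic geodesics and nearest boundary points need not exist,
    and f has no given extension to the closure of G. Hence almost nearest boundary points, and
    Cauchy families whose limits contradict the continuity of f or of its inverse. Weak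
    quasisymmetry is not assumed of the inverse, so the second local estimate has to be extracted
    from f itself. Logarithms never appear: an integer exponent of a fixed ratio 1 + tau plays their
    part. The comparison of growth is used at two scales. With A = 1 it shows that, up to a factor
    C, delta' only increases along the image until its maximum. With A = 2C it controls the pieces
    between successive drops of a bound on delta' by the factor 2C, and their sizes form a geometric
    series. An error eps < 1 is harmless along chains of balls but not when k(x, y) is tiny; there
    only the relative bound on eps helps. *)

Lemma within_continuous_mdistP (T : pseudoMetricType R) (X : metricType R)
    (A : set T) (f : T -> X) :
  {within A, continuous f} <->
  (forall x, A x -> forall e, 0 < e -> exists2 d, 0 < d &
     forall y, A y -> ball x d y -> mdist (f x) (f y) < e).
Proof.
rewrite subspace_continuousP; split => cf x Ax.
  move=> e e0.
  have /metricType_numDomainType.cvgrPdist_lt/(_ e e0) := cf x Ax.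
  rewrite near_withinE => /nbhs_ballP[d /= d0 dP].
  by exists d => // y Ay xy; exact: dP.
apply/metricType_numDomainType.cvgrPdist_lt => e e0.
have [d d0 dP] := cf x Ax e e0.
rewrite near_withinE; apply/nbhs_ballP; exists d => //= y xy Ay; exact: dP.
Qed.

Lemma within_continuous_realP (T : pseudoMetricType R) (A : set T)
    (f : T -> R) :
  {within A, continuous f} <->
  (forall x, A x -> forall e, 0 < e -> exists2 d, 0 < d &
     forall y, A y -> ball x d y -> `|f x - f y| < e).
Proof.
rewrite subspace_continuousP; split => cf x Ax.
  move=> e e0; have /cvgrPdist_lt/(_ e e0) := cf x Ax.
  rewrite near_withinE => /nbhs_ballP[d /= d0 dP].
  by exists d => // y Ay xy; exact: dP.
apply/cvgrPdist_lt => e e0; have [d d0 dP] := cf x Ax e e0.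
rewrite near_withinE; apply/nbhs_ballP; exists d => //= y xy Ay; exact: dP.
Qed.

Lemma itv_continuousP (X : metricType R) a b (g : R -> X) :
  {within `[a, b], continuous g} <->
  (forall t, t \in `[a, b] -> forall e, 0 < e -> exists2 d, 0 < d &
     forall s, s \in `[a, b] -> `|t - s| < d -> mdist (g t) (g s) < e).
Proof. exact: within_continuous_mdistP. Qed.

(** The infimum of the hitting times is itself a hitting time because F is closed. *)
Lemma first_hit (X : topologicalType) a b (g : R -> X) (F : set X) t :
  {within `[a, b], continuous g} -> closed F -> t \in `[a, b] -> F (g t) ->
  exists t0, [/\ t0 \in `[a, b], t0 <= t, F (g t0) &
    forall s, s \in `[a, b] -> s < t0 -> ~ F (g s)].
Proof.
move=> /subspace_continuousP cg cF tab Ft.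
pose S := [set s | s \in `[a, b] /\ F (g s)].
have hS : has_inf S.
  by split; [exists t | exists a => s [/itvP sab _]; rewrite sab].
have St : inf S <= t by apply: ge_inf => //; case: hS.
have Sab : inf S \in `[a, b].
  rewrite in_itv/=; apply/andP; split.
    by apply: lb_le_inf; [case: hS | move=> s [/itvP sab _]; rewrite sab].
  by apply: le_trans St _; rewrite (itvP tab).
exists (inf S); split => //; last first.
  move=> s sab sS Fs; move: sS; rewrite ltNge => /negP; apply.
  by apply: ge_inf; [case: hS | split].
apply: cF => B nB.
have := cg _ Sab _ nB.
rewrite /= nbhs_simpl/= => /nbhs_ballP[d /= d0 dB].
have [s [sab Fs] sd] := inf_adherent d0 hS.
exists (g s); split => //.
apply: dB => //=.
have : inf S <= s by apply: ge_inf; [case: hS | split].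
by rewrite -subr_ge0 => ?; rewrite /ball/= distrC ger0_norm // ltrBlDl.
Qed.

Lemma itv_cvg_left (X : topologicalType) a b (g : R -> X) (F : set X) t :
  {within `[a, b], continuous g} -> closed F -> t \in `[a, b] -> a < t ->
  (forall s, s \in `[a, b] -> s < t -> F (g s)) -> F (g t).
Proof.
move=> /subspace_continuousP cg cF tab at_ Fs.
apply: cF => B nB.
have := cg _ tab _ nB.
rewrite /= nbhs_simpl/= => /nbhs_ballP[d /= d0 dB].
pose s := Num.max a (t - d / 2).
have st : s < t by rewrite gt_max at_/= gtrBl divr_gt0.
have sab : s \in `[a, b].
  rewrite in_itv/= le_max lexx/=; apply: le_trans (ltW st) _.
  by rewrite (itvP tab).
exists (g s); split; first exact: Fs.
apply: dB => //=; rewrite /ball/= ger0_norm ?subr_ge0 ?(ltW st)//.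
rewrite ltrBlDr -ltrBlDl lt_max; apply/orP; right.
by rewrite ltrD2l ltrN2 ltr_pdivrMr// ltr_pMr// ltr1n.
Qed.

End continuity.

(** * Length of curves: additivity, one-sided continuity, intermediate values *)

Section length.
Context {R : realType} {X : metricType R}.
Implicit Types (g : R -> X) (a b c s t : R).

(** Structural form of [curve_sum], which reads the partition through [nth]; it allows induction on
    partitions. *)
Fixpoint chain_sum g a (p : seq R) : R :=
  if p is x :: p' then mdist (g a) (g x) + chain_sum g x p' else 0.

Lemma curve_sumE g a b p : curve_sum a b g p = chain_sum g a p.
Proof.
rewrite /curve_sum; elim: p a => [|x p IH] a /=; first by rewrite big_geq.
by rewrite big_nat_recl//= -IH.
Qed.

Lemma chain_sum_le_length g a b p : path <%R a p -> last a p = b ->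
  ((chain_sum g a p)%:E <= curve_length a b g)%E.
Proof.
move=> pap lap; apply: ereal_sup_ubound; exists p; last by rewrite curve_sumE.
by split => //; apply/eqP.
Qed.

Lemma curve_length_leP g a b l : reflect
  (forall p, path <%R a p -> last a p = b -> ((chain_sum g a p)%:E <= l)%E)
  (curve_length a b g <= l)%E.
Proof.
apply: (iffP ereal_supP) => [gl p pap lap|gl _ [p [pap /eqP lap] <-]].
  by apply: gl; exists p; [split => //; apply/eqP | rewrite curve_sumE].
by rewrite curve_sumE; exact: gl.
Qed.

Lemma mdist_le_length g a b : a <= b ->
  ((mdist (g a) (g b))%:E <= curve_length a b g)%E.
Proof.
rewrite le_eqVlt => /predU1P[->|ab].
  by rewrite mdistxx; exact: (@chain_sum_le_length g b b [::]).
have := @chain_sum_le_length g a b [:: b]; rewrite /= ab addr0; exact.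
Qed.

Lemma curve_length_ge0 g a b : a <= b -> (0 <= curve_length a b g)%E.
Proof.
by move=> /(mdist_le_length g); apply: le_trans; rewrite lee_fin mdist_ge0.
Qed.

Lemma curve_length_xx g a : curve_length a a g = 0%E.
Proof.
apply/eqP; rewrite eq_le curve_length_ge0// andbT.
apply/curve_length_leP => -[|x p] //= /andP[ax pxp] lxp.
suff : x <= last x p by rewrite lxp leNgt ax.
elim: p x {ax lxp} pxp => //= y p IH x /andP[xy /IH]; exact/le_trans/ltW.
Qed.

Lemma path_last_le a p : path <%R a p -> a <= last a p.
Proof. by elim: p a => //= y p IH x /andP[xy /IH]; exact/le_trans/ltW. Qed.

Lemma chain_sum_cat g a p q :
  chain_sum g a (p ++ q) = chain_sum g a p + chain_sum g (last a p) q.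
Proof. by elim: p a => [|x p IH] a /=; rewrite ?add0r// IH addrA. Qed.

Lemma curve_length_split_le g a c b : a <= c -> c <= b ->
  (curve_length a c g + curve_length c b g <= curve_length a b g)%E.
Proof.
move=> ac cb.
have H p : path <%R a p -> last a p = c ->
    ((chain_sum g a p)%:E + curve_length c b g <= curve_length a b g)%E.
  move=> pap lap.
  rewrite addeC -leeBrDr//; apply/curve_length_leP => q pcq lcq.
  rewrite leeBrDr// -EFinD addrC -lap -chain_sum_cat chain_sum_le_length//.
    by rewrite cat_path pap lap.
  by rewrite last_cat lap.
(* Moving a length to the other side requires it to be finite, so the infinite case is treated
   apart. *)
have [lcb|lcb] := eqVneq (curve_length c b g) +oo%E.
  suff -> : curve_length a b g = +oo%E by rewrite leey.
  apply/eqP; rewrite -leye_eq; move: ac; rewrite le_eqVlt => /predU1P[->|ac].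
    by rewrite lcb.
  by have := H [:: c]; rewrite /= ac addr0 lcb addey//; exact.
have fcb : curve_length c b g \is a fin_num.
  by rewrite ge0_fin_numE ?curve_length_ge0// ltey.
rewrite -leeBrDr//; apply/curve_length_leP => p pap lap.
by rewrite leeBrDr//; exact: H.
Qed.

Lemma chain_sum_split g a c b p : a <= c -> c <= b ->
  path <%R a p -> last a p = b -> exists p1 p2,
  [/\ path <%R a p1 /\ last a p1 = c, path <%R c p2 /\ last c p2 = b &
      chain_sum g a p <= chain_sum g a p1 + chain_sum g c p2].
Proof.
elim: p a => [|x p IH] a ac cb /=.
  move=> _ ab; have ? : a = c by apply/eqP; rewrite eq_le ac ab cb.
  by subst; exists [::], [::]; split => //=; rewrite addr0.
move=> /andP[ax pxp] lxp; have [xc|cx] := leP x c.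
  have [p1 [p2 [[xp1 lp1] cp2 pp]]] := IH x xc cb pxp lxp.
  exists (x :: p1), p2; split => //=; first by rewrite ax.
  by rewrite -addrA lerD2l.
have [ac'|ca] := ltP a c; last first.
  have ? : a = c by apply/eqP; rewrite eq_le ac ca.
  by subst; exists [::], (x :: p); split => //=; rewrite ?ax// add0r.
exists [:: c], (x :: p); split => //=; rewrite ?ac'// ?cx//.
by rewrite addr0 addrA lerD2r metric_triangle.
Qed.

Lemma curve_lengthD g a c b : a <= c -> c <= b ->
  curve_length a b g = (curve_length a c g + curve_length c b g)%E.
Proof.
move=> ac cb; apply/eqP; rewrite eq_le curve_length_split_le// andbT.
apply/curve_length_leP => p pap lap.
have [p1 [p2 [[? ?] [? ?] pp]]] := chain_sum_split g ac cb pap lap.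
apply: (@le_trans _ _ (chain_sum g a p1 + chain_sum g c p2)%:E).
  by rewrite lee_fin.
by rewrite EFinD leeD// chain_sum_le_length.
Qed.

Lemma curve_length_shift_le g h a b r :
  (forall t, t \in `[a, b] -> g t = h (t + r)) ->
  (curve_length a b g <= curve_length (a + r) (b + r) h)%E.
Proof.
move=> gh; apply/curve_length_leP => p pap lap.
have -> : chain_sum g a p = chain_sum h (a + r) (map (+%R^~ r) p).
  have : forall x, a <= x -> path <%R x p -> last x p = b ->
      chain_sum g x p = chain_sum h (x + r) (map (+%R^~ r) p).
    elim: p {pap lap} => //= y p IH x ax /andP[xy pyp] lyp.
    have yb := path_last_le pyp; rewrite lyp in yb.
    rewrite -IH// ?(le_trans ax (ltW xy))// !gh// in_itv/=.
      by rewrite (le_trans ax (ltW xy)).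
    by rewrite ax (le_trans (ltW xy)).
  by apply.
apply: chain_sum_le_length; last by rewrite (last_map (+%R^~ r)) lap.
by apply: (homo_path (f := +%R^~ r)) pap => x y /=; rewrite ltrD2r.
Qed.

Lemma curve_length_shift g h a b r :
  (forall t, t \in `[a, b] -> g t = h (t + r)) ->
  curve_length a b g = curve_length (a + r) (b + r) h.
Proof.
move=> gh; apply/eqP; rewrite eq_le curve_length_shift_le//=.
rewrite -[X in (_ <= curve_length X _ _)%E](addrK r).
rewrite -[X in (_ <= curve_length _ X _)%E](addrK r).
apply: curve_length_shift_le => t; rewrite in_itv/= => /andP[at_ tb].
by rewrite gh ?subrK// in_itv/= lerBrDr at_ lerBlDr.
Qed.

(** Take for c the next-to-last vertex: beyond it, moving the end of the partition from t back to s
    costs only the chord from g s to g t. For almost optimal partitions this turns continuity of g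
    into left continuity of the length. *)
Lemma chain_sum_cut_left g a t p : path <%R a p -> last a p = t -> a < t ->
  exists2 c, a <= c < t & forall s, c <= s -> s < t ->
  ((chain_sum g a p)%:E <= curve_length a s g + (mdist (g s) (g t))%:E)%E.
Proof.
elim: p a => [|x p IH] a /=; first by move=> _ ->; rewrite ltxx.
move=> /andP[ax pxp] lxp at_; have [xt|tx] := ltP x t.
  have [c /andP[xc ct] cs] := IH x pxp lxp xt.
  exists c; first by rewrite (le_trans (ltW ax)).
  move=> s cs' st; rewrite (curve_lengthD _ (ltW ax)) ?(le_trans xc)//.
  by rewrite EFinD -addeA leeD ?mdist_le_length ?(ltW ax) ?cs.
have xt : x = t by apply/eqP; rewrite eq_le tx -lxp path_last_le.
exists a; rewrite ?lexx//= => s as_ st.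
have -> : p = [::].
  case: p {IH} pxp lxp => //= y p /andP[xy /path_last_le yp] l.
  by move: yp; rewrite l -xt leNgt xy.
rewrite /= addr0 xt; apply: le_trans (_ : (mdist (g a) (g s) +
  mdist (g s) (g t))%:E <= _)%E; first by rewrite lee_fin metric_triangle.
by rewrite EFinD leeD2r// mdist_le_length.
Qed.

Lemma chain_sum_cut_right g t b p : path <%R t p -> last t p = b -> t < b ->
  exists2 c, t < c <= b & forall s, t <= s -> s < c ->
  ((chain_sum g t p)%:E <= (mdist (g t) (g s))%:E + curve_length s b g)%E.
Proof.
case: p => [|x p] /=; first by move=> _ ->; rewrite ltxx.
move=> /andP[tx pxp] lxp tb; have xb := path_last_le pxp; rewrite lxp in xb.
exists x; rewrite ?tx// => s ts sx.
apply: (@le_trans _ _ ((mdist (g t) (g s))%:E +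
    (chain_sum g s (x :: p))%:E)%E).
  by rewrite -EFinD lee_fin /= addrA lerD2r metric_triangle.
by rewrite leeD2l// chain_sum_le_length//= sx.
Qed.

Lemma rectifiable_sub g a b s t : rectifiable a b g ->
  a <= s -> s <= t -> t <= b -> rectifiable s t g.
Proof.
move=> rg as_ st tb; apply: le_lt_trans rg.
rewrite (curve_lengthD g as_ (le_trans st tb)) (curve_lengthD g st tb).
rewrite addeCA leeDl// adde_ge0 ?curve_length_ge0//.
Qed.

Definition len g a b : R := fine (curve_length a b g).

Lemma lenE g a b : a <= b -> rectifiable a b g ->
  curve_length a b g = (len g a b)%:E.
Proof. by move=> ab rg; rewrite fineK// ge0_fin_numE// curve_length_ge0. Qed.

Lemma len_ge0 g a b : a <= b -> 0 <= len g a b.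
Proof. by move=> ab; rewrite fine_ge0// curve_length_ge0. Qed.

Lemma len_xx g a : len g a a = 0.
Proof. by rewrite /len curve_length_xx. Qed.

Lemma lenD g a c b : a <= c -> c <= b -> rectifiable a b g ->
  len g a b = len g a c + len g c b.
Proof.
move=> ac cb rg.
rewrite /len (curve_lengthD g ac cb) fineD// ge0_fin_numE ?curve_length_ge0//.
  exact: rectifiable_sub rg _ _ _.
exact: rectifiable_sub rg _ _ _.
Qed.

Lemma mdist_le_len g a b : a <= b -> rectifiable a b g ->
  mdist (g a) (g b) <= len g a b.
Proof. by move=> ab rg; rewrite -lee_fin -lenE// mdist_le_length. Qed.

Lemma len_left g a b t e : {within `[a, b], continuous g} ->
  rectifiable a b g -> a < t -> t <= b -> 0 < e ->
  exists s, [/\ a <= s, s < t & len g a t < len g a s + e].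
Proof.
move=> /itv_continuousP cg rg at_ tb e0.
have e20 : 0 < e / 2 by rewrite divr_gt0.
have rt := rectifiable_sub rg (lexx a) (ltW at_) tb.
have ft : curve_length a t g \is a fin_num.
  by rewrite ge0_fin_numE// curve_length_ge0// ltW.
have [_ [p [pap /eqP lap] <-]] := ub_ereal_sup_adherent e20 ft.
rewrite curve_sumE -/(curve_length a t g) lenE// ?(ltW at_)// -EFinB lte_fin.
move=> pt; have [c /andP[ac ct] cP] := chain_sum_cut_left g pap lap at_.
have tab : t \in `[a, b] by rewrite in_itv/= (ltW at_).
have [d d0 dP] := cg t tab _ e20.
pose s := Num.max c (t - d / 2).
have st : s < t by rewrite gt_max ct gtrBl divr_gt0.
have cs : c <= s by rewrite le_max lexx.
exists s; split => //; first exact: le_trans ac cs.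
have rs := rectifiable_sub rg (lexx a) (le_trans ac cs) (le_trans (ltW st) tb).
have := cP s cs st; rewrite lenE ?(le_trans ac cs)// -EFinD lee_fin => h.
have : mdist (g t) (g s) < e / 2.
  apply: dP; first by rewrite in_itv/= (le_trans ac cs) (le_trans (ltW st)).
  rewrite ger0_norm ?subr_ge0 ?(ltW st)//.
  rewrite ltrBlDr -ltrBlDl lt_max; apply/orP; right.
  by rewrite ltrD2l ltrN2 ltr_pdivrMr// ltr_pMr// ltr1n.
rewrite metric_sym; lra.
Qed.

Lemma len_right g a b t e : {within `[a, b], continuous g} ->
  rectifiable a b g -> a <= t -> t < b -> 0 < e ->
  exists s, [/\ t < s, s <= b & len g a s < len g a t + e].
Proof.
move=> /itv_continuousP cg rg at_ tb e0.
have e20 : 0 < e / 2 by rewrite divr_gt0.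
have rt := rectifiable_sub rg at_ (ltW tb) (lexx b).
have ft : curve_length t b g \is a fin_num.
  by rewrite ge0_fin_numE// curve_length_ge0// ltW.
have [_ [p [pap /eqP lap] <-]] := ub_ereal_sup_adherent e20 ft.
rewrite curve_sumE -/(curve_length t b g) lenE// ?(ltW tb)// -EFinB lte_fin.
move=> pt; have [c /andP[tc cb] cP] := chain_sum_cut_right g pap lap tb.
have tab : t \in `[a, b] by rewrite in_itv/= (ltW tb) at_.
have [d d0 dP] := cg t tab _ e20.
pose s := Num.min ((t + c) / 2) (t + d / 2).
have ts : t < s by rewrite lt_min ltrDl divr_gt0// midf_lt.
have sc : s < c by rewrite gt_min midf_lt.
have sb := le_trans (ltW sc) cb.
exists s; split => //.
have rs := rectifiable_sub rg (le_trans at_ (ltW ts)) sb (lexx b).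
have := cP s (ltW ts) sc; rewrite lenE// -EFinD lee_fin => h.
have : mdist (g t) (g s) < e / 2.
  apply: dP; first by rewrite in_itv/= sb (le_trans at_ (ltW ts)).
  rewrite distrC ger0_norm ?subr_ge0 ?(ltW ts)//.
  rewrite ltrBlDl gt_min; apply/orP; right.
  by rewrite ltrD2l ltr_pdivrMr// ltr_pMr// ltr1n.
have := lenD at_ (ltW tb) rg; have := lenD (le_trans at_ (ltW ts)) sb rg.
lra.
Qed.

Lemma len_homo g a b s t : rectifiable a b g -> a <= s -> s <= t -> t <= b ->
  len g a s <= len g a t.
Proof.
move=> rg as_ st tb.
rewrite (lenD as_ st) ?lerDl ?len_ge0//.
exact: rectifiable_sub rg _ (le_trans as_ st) tb.
Qed.

Lemma len_IVT g a b v : a <= b -> {within `[a, b], continuous g} ->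
  rectifiable a b g -> 0 <= v -> v <= len g a b ->
  exists2 t, t \in `[a, b] & len g a t = v.
Proof.
move=> ab cg rg v0 vb.
pose S := [set t | t \in `[a, b] /\ len g a t <= v].
have hS : has_sup S.
  split; first by exists a; split; rewrite ?in_itv/= ?lexx//= len_xx.
  by exists b => s [/itvP sab _]; rewrite sab.
have aS : a <= sup S.
  by apply: sup_upper_bound => //; split; rewrite ?in_itv/= ?lexx//= len_xx.
have Sb : sup S <= b.
  by apply: ge_sup => [|s [/itvP sab _]]; [case: hS | rewrite sab].
exists (sup S); first by rewrite in_itv/= aS.
apply/eqP; rewrite eq_le; apply/andP; split.
  rewrite leNgt; apply/negP => vS.
  move: aS; rewrite le_eqVlt => /predU1P[aS|aS].
    by move: vS; rewrite -aS len_xx ltNge v0.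
  have e0 : 0 < len g a (sup S) - v by rewrite subr_gt0.
  have [s [as_ sS sl]] := len_left cg rg aS Sb e0.
  have d0 : 0 < sup S - s by rewrite subr_gt0.
  have [u [/itvP uab uv]] := sup_adherent d0 hS.
  rewrite opprB addrC subrK => su.
  have : len g a s <= len g a u by apply: len_homo rg _ _ _; rewrite ?uab// ltW.
  lra.
rewrite leNgt; apply/negP => vS.
move: Sb; rewrite le_eqVlt => /predU1P[Sb|Sb].
  by move: vS; rewrite Sb ltNge vb.
have e0 : 0 < v - len g a (sup S) by rewrite subr_gt0.
have [s [sS sb sl]] := len_right cg rg aS Sb e0.
have : s <= sup S.
  apply: sup_upper_bound => //; split; last by lra.
  by rewrite in_itv/= sb (le_trans aS (ltW sS)).
by rewrite leNgt sS.
Qed.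

End length.

(** * Quasihyperbolic length *)

Section bdist.
Context {R : realType} {X : metricType R}.
Variable G : set X.
Hypothesis bG : boundary G !=set0.
Implicit Types z w : X.

Let has_inf_bdist z : has_inf [set mdist z w | w in boundary G].
Proof.
split; first by have [w bw] := bG; exists (mdist z w), w.
by exists 0 => _ [w _ <-]; exact: mdist_ge0.
Qed.

Lemma bdist_le z w : boundary G w -> bdist G z <= mdist z w.
Proof. by move=> bw; apply: ge_inf; [case: (has_inf_bdist z) | exists w]. Qed.

Lemma bdist_ge0 z : 0 <= bdist G z.
Proof.
apply: lb_le_inf; first by case: (has_inf_bdist z).
by move=> _ [w _ <-]; exact: mdist_ge0.
Qed.

Lemma bdist_lipschitz z w : bdist G z <= mdist z w + bdist G w.
Proof.
rewrite -lerBlDl; apply: lb_le_inf; first by case: (has_inf_bdist w).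
move=> _ [v bv <-]; rewrite lerBlDl (le_trans (bdist_le z bv))//.
exact: metric_triangle.
Qed.

Lemma bdist_adherent z e : 0 < e ->
  exists2 w, boundary G w & mdist z w < bdist G z + e.
Proof.
by move=> e0; have [_ [w bw <-] wz] := inf_adherent e0 (has_inf_bdist z);
  exists w.
Qed.

Hypothesis oG : open G.

Lemma bdist_gt0 z : G z -> 0 < bdist G z.
Proof.
move=> Gz; have := open_nbhs_nbhs (conj oG Gz).
move=> /nbhs_ballP[r /= r0 rG]; apply: lt_le_trans r0 _.
apply: lb_le_inf; first by case: (has_inf_bdist z).
move=> _ [w [_ Gw] <-]; rewrite leNgt; apply/negP => zw; apply: Gw.
by rewrite (interior_id G).1//; apply: rG; rewrite ballEmdist.
Qed.

Lemma bdist_inv_continuous z : G z -> forall e, 0 < e -> exists2 d, 0 < d &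
  forall w, G w -> mdist z w < d -> `|(bdist G z)^-1 - (bdist G w)^-1| < e.
Proof.
move=> Gz e e0; have z0 := bdist_gt0 Gz.
set k := bdist G z in z0 *.
(* The first bound keeps the distance m of w to the boundary above k / 2, so that the second one
   makes |m - k| / (k m) smaller than e. *)
exists (Num.min (k / 2) (e * k ^+ 2 / 2)).
  by rewrite lt_min !divr_gt0// mulr_gt0// exprn_gt0.
move=> w Gw; rewrite lt_min => /andP[zw1 zw2].
have w0 := bdist_gt0 Gw; have := bdist_lipschitz z w.
have := bdist_lipschitz w z; rewrite metric_sym.
rewrite -/k; set m := bdist G w in w0 * => h1 h2.
have hm : k / 2 < m by lra.
have -> : k^-1 - m^-1 = (m - k) / (k * m) by field; rewrite !gt_eqF.
rewrite normrM normfV (gtr0_norm (mulr_gt0 z0 w0)) ltr_pdivrMr ?mulr_gt0//.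
have : `|m - k| <= mdist z w by rewrite ler_norml; apply/andP; split; lra.
move=> /le_lt_trans; apply; apply: lt_trans zw2 _.
rewrite -mulrA ltr_pM2l// expr2 -mulrA ltr_pM2l//.
Qed.

End bdist.

(** * Parametrization by arc length *)

Section param.
Context {R : realType} {X : metricType R}.
Variables (g : R -> X) (a b : R).
Hypotheses (ag : arc a b g) (rg : rectifiable a b g).

Let ab : a <= b. Proof. by case: ag. Qed.
Let cg : {within `[a, b], continuous g}. Proof. by case: ag. Qed.
Let ig : {in `[a, b] &, injective g}. Proof. by case: ag. Qed.

Lemma len_strict s t : a <= s -> s < t -> t <= b -> len g a s < len g a t.
Proof.
move=> as_ st tb.
have rt := rectifiable_sub rg (lexx a) (le_trans as_ (ltW st)) tb.
have rs := rectifiable_sub rg as_ (ltW st) tb.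
rewrite (lenD as_ (ltW st) rt) ltrDl.
apply: lt_le_trans (mdist_le_len (ltW st) rs).
rewrite mdist_gt0; apply/eqP => /ig; rewrite !in_itv/= as_ tb.
rewrite (le_trans as_ (ltW st)) (le_trans (ltW st) tb) => /(_ isT isT) e.
by rewrite e ltxx in st.
Qed.

Lemma arclength_paramE t : t \in `[a, b] ->
  arclength_param a b g (len g a t) = g t.
Proof.
move=> tab; rewrite /arclength_param; congr g.
have atb : a <= t /\ t <= b by move: tab; rewrite in_itv/= => /andP.
have [at_ tb] := atb.
apply: xget_unique => [|s [sab]].
  by split => //; rewrite -lenE//; exact: rectifiable_sub rg _ _ _.
have /andP[as_ sb] : a <= s <= b by move: sab; rewrite in_itv.
rewrite lenE//; last exact: rectifiable_sub rg _ _ _.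
move=> [e]; apply/eqP; rewrite eq_le !leNgt; apply/andP; split; apply/negP.
  by move=> ts; have := len_strict at_ ts sb; rewrite e ltxx.
by move=> st; have := len_strict as_ st tb; rewrite e ltxx.
Qed.

(** Outside the range of the length, [xget] returns its default a, still a parameter of the arc.
    Bounds on the integrand therefore hold for every s. *)
Lemma arclength_param_in s : exists2 t, t \in `[a, b] &
  arclength_param a b g s = g t.
Proof.
rewrite /arclength_param; case: xgetP => [t _ [tab _]|_]; first by exists t.
by exists a => //; rewrite in_itv/= lexx.
Qed.

Lemma arclength_param_lipschitz s t : 0 <= s -> s <= t -> t <= len g a b ->
  mdist (arclength_param a b g s) (arclength_param a b g t) <= t - s.
Proof.
move=> s0 st tL.
have [u uab us] := len_IVT ab cg rg s0 (le_trans st tL).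
have [v vab vt] := len_IVT ab cg rg (le_trans s0 st) tL.
rewrite -us -vt !arclength_paramE// -?us -?vt//.
have /andP[au ub] : a <= u <= b by move: uab; rewrite in_itv.
have /andP[av vb] : a <= v <= b by move: vab; rewrite in_itv.
have uv : u <= v.
  rewrite leNgt; apply/negP => vu.
  by have := len_strict av vu ub; rewrite us vt ltNge st.
rewrite (lenD au uv); last exact: rectifiable_sub rg _ _ _.
rewrite addrC addKr mdist_le_len//; exact: rectifiable_sub rg _ _ _.
Qed.

End param.

(** * Translation invariance of the Lebesgue integral *)

Section shift.
Context {R : realType}.
Local Notation mu := (@lebesgue_measure R).

Lemma preimage_shift_itv (b0 b1 : bool) (x y r : R) :
  +%R^~ r @^-1` [set` Interval (BSide b0 x) (BSide b1 y)] =
  [set` Interval (BSide b0 (x - r)) (BSide b1 (y - r))].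
Proof.
apply/seteqP; split => z /=; rewrite !in_itv/=;
  by case: b0; case: b1; rewrite /= ?lerBlDr ?lerBrDr ?ltrBlDr ?ltrBrDr.
Qed.

Lemma measurable_shift (r : R) :
  measurable_fun setT (+%R^~ r : measurableTypeR R -> measurableTypeR R).
Proof.
by apply: continuous_measurable_fun => x; apply: cvgD;
  [exact: cvg_id | exact: cvg_cst].
Qed.

Lemma pushforward_shift_lebesgue (r : R) (A : set R) : measurable A ->
  pushforward mu (+%R^~ r : _ -> measurableTypeR R) A = mu A.
Proof.
move=> mA; apply/esym/lebesgue_measure_unique => //=.
  exact: measurable_shift.
by move=> ? _ [[x y]] _ <-; rewrite /pushforward preimage_shift_itv/=
    !lebesgue_measure_itv/= !lte_fin ltrD2r -!EFinB opprB addrA subrK.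
Qed.

Lemma ge0_integral_shift (f : R -> \bar R) (x y r : R) :
  measurable_fun `[x + r, y + r] f ->
  {in `[x + r, y + r], forall z, (0 <= f z)%E} ->
  (\int[mu]_(z in `[(x + r)%R, (y + r)%R]) f z =
   \int[mu]_(z in `[x, y]) f (z + r)%R)%E.
Proof.
move=> mf f0.
have -> : `[x, y]%classic = +%R^~ r @^-1` `[x + r, y + r].
  by rewrite preimage_shift_itv !addrK.
rewrite -[RHS](ge0_integral_pushforward (measurable_shift r) mu).
- apply: eq_measure_integral; first exact: measurable_shift.
  by move=> ? A mA _; exact: (esym (pushforward_shift_lebesgue r mA)).
- exact: measurable_itv.
- exact: mf.
- by move=> z; rewrite inE/= => zi; exact: f0.
Qed.

End shift.

(** * Additivity of quasihyperbolic length and the triangle inequality *)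

Section qh_length.
Context {R : realType} {X : metricType R}.
Variable G : set X.
Hypotheses (oG : open G) (bG : boundary G !=set0).

Definition qh_arc a b (g : R -> X) :=
  [/\ arc a b g, g @` `[a, b] `<=` G & rectifiable a b g].

Section one_arc.
Variables (a b : R) (g : R -> X).
Hypothesis qg : qh_arc a b g.

Let ab : a <= b. Proof. by case: qg => -[]. Qed.
Let ag : arc a b g. Proof. by case: qg. Qed.
Let cg : {within `[a, b], continuous g}. Proof. by case: qg => -[]. Qed.
Let rg : rectifiable a b g. Proof. by case: qg. Qed.

Lemma qh_arc_in t : t \in `[a, b] -> G (g t).
Proof. by move=> tab; case: qg => _ gG _; apply: gG; exists t. Qed.

Lemma qh_arc_sub s t : a <= s -> s <= t -> t <= b -> qh_arc s t g.
Proof.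
move=> as_ st tb; have sub : `[s, t] `<=` `[a, b].
  by apply: subset_itv; rewrite bnd_simp.
split; last exact: rectifiable_sub rg _ _ _.
  split => //; first exact: continuous_subspaceW cg.
  by move=> u v us vs; case: ag => _ _ /(_ u v (sub u us) (sub v vs)).
by move=> _ [u us <-]; apply: qh_arc_in; exact: sub.
Qed.

Let F s := (bdist G (arclength_param a b g s))^-1.

Lemma arclength_param_qh_arc s : G (arclength_param a b g s).
Proof. by have [t tab ->] := arclength_param_in ag s; exact: qh_arc_in. Qed.

Lemma qh_density_ge0 s : 0 <= F s.
Proof. by rewrite invr_ge0 bdist_ge0. Qed.

Lemma qh_density_continuous : {within `[0, len g a b], continuous F}.
Proof.
apply/within_continuous_realP => s /= sL e e0.
have [d d0 dP] := bdist_inv_continuous bG oG (arclength_param_qh_arc s) e0.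
exists d => // t tL; rewrite /ball/= => st.
apply: dP; first exact: arclength_param_qh_arc.
move: sL tL; rewrite !in_itv/= => /andP[s0 sL] /andP[t0 tL].
have [le_st|/ltW le_ts] := leP s t.
  apply: le_lt_trans (arclength_param_lipschitz ag rg s0 le_st tL) _.
  by rewrite -[t - s]ger0_norm ?subr_ge0// distrC.
rewrite metric_sym.
apply: le_lt_trans (arclength_param_lipschitz ag rg t0 le_ts sL) _.
by rewrite -[s - t]ger0_norm ?subr_ge0.
Qed.

Lemma measurable_qh_density : measurable_fun `[0, len g a b] (EFin \o F).
Proof.
apply/measurable_EFinP; apply: subspace_continuous_measurable_fun => //.
exact: qh_density_continuous.
Qed.

Lemma qh_length_ge0 : (0 <= qh_length G a b g)%E.
Proof. by apply: integral_ge0 => s _; rewrite lee_fin qh_density_ge0. Qed.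

Lemma qh_length_le M : 0 < M -> (forall t, t \in `[a, b] -> M <= bdist G (g t)) ->
  (qh_length G a b g <= (len g a b / M)%:E)%E.
Proof.
move=> M0 gM; rewrite /qh_length /line_integral -/(len g a b).
apply: (@le_trans _ _
    (\int[lebesgue_measure]_(s in `[0%R, len g a b]) (M^-1)%:E)%E).
  apply: ge0_le_integral => //=.
  - by move=> s _; rewrite lee_fin qh_density_ge0.
  - exact: measurable_qh_density.
  - move=> s _; have [t tab ->] := arclength_param_in ag s.
    by rewrite lee_fin lef_pV2 ?posrE ?gM// (lt_le_trans M0) ?gM.
rewrite integral_cst//= lebesgue_measure_itv/= lte_fin.
case: ltP => L0; first by rewrite sube0 -EFinM mulrC.
by rewrite mule0 lee_fin divr_ge0 ?len_ge0// ltW.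
Qed.

Lemma qh_length_ge M : 0 < M -> (forall t, t \in `[a, b] -> bdist G (g t) <= M) ->
  ((len g a b / M)%:E <= qh_length G a b g)%E.
Proof.
move=> M0 gM; rewrite /qh_length /line_integral -/(len g a b).
apply: (@le_trans _ _
    (\int[lebesgue_measure]_(s in `[0%R, len g a b]) (M^-1)%:E)%E).
  rewrite integral_cst//= lebesgue_measure_itv/= lte_fin.
  case: ltP => L0; first by rewrite sube0 -EFinM mulrC.
  have -> : len g a b = 0 by apply/eqP; rewrite eq_le L0 len_ge0.
  by rewrite mul0r mule0.
apply: ge0_le_integral => //=.
- by move=> s _; rewrite lee_fin invr_ge0 ltW.
- exact: measurable_qh_density.
- move=> s _; have [t tab ->] := arclength_param_in ag s.
  have ? := bdist_gt0 bG oG (qh_arc_in tab).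
  by rewrite lee_fin lef_pV2 ?posrE ?gM.
Qed.

End one_arc.

(** The integrand depends on arc length measured from a. On the first piece it is unchanged; on the
    second it is shifted by the length of the first, hence the translation of the integral. *)
Lemma qh_lengthD a c b (g : R -> X) : qh_arc a b g -> a <= c -> c <= b ->
  qh_length G a b g = (qh_length G a c g + qh_length G c b g)%E.
Proof.
move=> qg ac cb.
have [ag gG rg] := qg.
have qac := qh_arc_sub qg (lexx a) ac cb.
have qcb := qh_arc_sub qg ac cb (lexx b).
have [agc _ rgc] := qac; have [acg _ rcg] := qcb.
have LE := lenD ac cb rg.
have L1 := len_ge0 g ac; have L2 := len_ge0 g cb.
rewrite /qh_length /line_integral -!/(len _ _ _).
set F := fun s => ((bdist G (arclength_param a b g s))^-1)%:E.
have mF : measurable_fun `[0, len g a b] F by exact: measurable_qh_density.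
have F0 s : (0 <= F s)%E by rewrite lee_fin invr_ge0 bdist_ge0.
have EU : `[0, len g a b]%classic =
    `[0, len g a c] `|` `]len g a c, len g a b].
  rewrite -itv_bndbnd_setU// bnd_simp// LE lerDl//.
have AB : [disjoint `[0, len g a c] & `]len g a c, len g a b]].
  apply/disj_setPRL => s /=; rewrite !in_itv/= => /andP[h _].
  by move=> /andP[_]; rewrite leNgt h.
rewrite EU ge0_integral_setU; first last.
- exact: AB.
- by move=> s _; exact: F0.
- by rewrite -EU; exact: mF.
- exact: measurable_itv.
- exact: measurable_itv.
apply: f_equal2.
  apply: eq_integral => s; rewrite inE/= in_itv/= => /andP[s0 sc].
  have [cg _] : {within `[a, c], continuous g} /\ True by case: agc.
  have [t tac <-] := len_IVT ac cg rgc s0 sc.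
  rewrite /F arclength_paramE// ?arclength_paramE//.
  by move: tac; rewrite !in_itv/= => /andP[-> /le_trans->].
have mF' : measurable_fun `[len g a c, len g a b] F.
  apply: measurable_funS mF => //; apply: subset_itvr; by rewrite bnd_simp.
rewrite integral_itv_obnd_cbnd; last first.
  apply: measurable_funS mF' => //; exact: subset_itv_oc_cc.
have -> : `[len g a c, len g a b]%classic =
    `[0 + len g a c, len g c b + len g a c]%classic.
  by rewrite add0r LE addrC.
rewrite ge0_integral_shift; last 2 first.
- by rewrite add0r addrC -LE.
- by move=> z _; exact: F0.
apply: eq_integral => s; rewrite inE/= in_itv/= => /andP[s0 sc].
have [cg _] : {within `[c, b], continuous g} /\ True by case: acg.
have [t tcb <-] := len_IVT cb cg rcg s0 sc.
have /andP[ct tb] : c <= t <= b by move: tcb; rewrite in_itv.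
have rt := rectifiable_sub rg (lexx a) (le_trans ac ct) tb.
rewrite /F addrC -(lenD ac ct rt) !arclength_paramE//.
by rewrite in_itv/= tb (le_trans ac ct).
Qed.

Lemma qh_length_shift a b c d (g h : R -> X) r :
  c = a + r -> d = b + r -> arc a b g -> rectifiable a b g -> arc c d h ->
  (forall t, t \in `[a, b] -> g t = h (t + r)) ->
  qh_length G a b g = qh_length G c d h.
Proof.
move=> -> -> ag rg ah gh.
have ab : a <= b by case: ag.
have cg : {within `[a, b], continuous g} by case: ag.
have EL := curve_length_shift gh.
have rh : rectifiable (a + r) (b + r) h by rewrite /rectifiable -EL.
rewrite /qh_length /line_integral -EL -!/(len _ _ _).
apply: eq_integral => s; rewrite inE/= in_itv/= => /andP[s0 sc].
have [t tab <-] := len_IVT ab cg rg s0 sc.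
rewrite arclength_paramE//.
have /andP[at_ tb] : a <= t <= b by move: tab; rewrite in_itv.
have -> : len g a t = len h (a + r) (t + r).
  rewrite /len (@curve_length_shift _ _ g h _ _ r)// => u.
  rewrite in_itv/= => /andP[au ut]; apply: gh.
  by rewrite in_itv/= au (le_trans ut).
by rewrite arclength_paramE ?gh// in_itv/= !lerD2r at_.
Qed.


Lemma arc_shift (a b r : R) (g h : R -> X) :
  (forall t, t \in `[a, b] -> g t = h (t + r)) -> arc a b g ->
  arc (a + r) (b + r) h.
Proof.
move=> gh [ab /itv_continuousP cg ig].
have sub t : t \in `[a + r, b + r] -> t - r \in `[a, b] /\ h t = g (t - r).
  rewrite !in_itv/= => /andP[at_ tb].
  have tab : a <= t - r <= b by rewrite lerBrDr at_ lerBlDr.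
  by split => //; rewrite gh ?in_itv// subrK.
split; first by rewrite lerD2r.
  apply/itv_continuousP => t /sub[tab ->] e e0.
  have [d d0 dP] := cg _ tab e e0; exists d => // s /sub[sab ->] ts.
  by apply: dP => //; rewrite opprB addrA subrK.
move=> t s; rewrite !inE => /sub[tab ->] /sub[sab ->] /ig.
by rewrite !inE => /(_ tab sab) /addIr.
Qed.

(** Arcs are injective, so plain concatenation fails when the two arcs meet elsewhere. The first is
    cut where it first meets the second, which is then followed from that point; the parts left out
    only decrease the length. *)
Lemma qh_arc_cat a b (g : R -> X) a' b' (g' : R -> X) :
  qh_arc a b g -> qh_arc a' b' g' -> g b = g' a' ->
  exists c d h, [/\ qh_arc c d h, h c = g a, h d = g' b' &
    (qh_length G c d h <= qh_length G a b g + qh_length G a' b' g')%E].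
Proof.
move=> qg qg' gg'; have [ag gG rg] := qg; have [ag' gG' rg'] := qg'.
have [ab cg ig] := ag; have [ab' cg' ig'] := ag'.
have cF : closed (g' @` `[a', b']).
  apply: compact_closed; first exact: metric_hausdorff.
  by apply: continuous_compact => //; exact: segment_compact.
have Fb : (g' @` `[a', b']) (g b) by exists a'; rewrite //= in_itv/= lexx.
have bab : b \in `[a, b] by rewrite in_itv/= lexx andbT.
have [t0 [tab t0b [s0 sab gts] nF]] := first_hit cg cF bab Fb.
have /andP[at0 _] : a <= t0 <= b by move: tab; rewrite in_itv.
have /andP[as0 s0b] : a' <= s0 <= b' by move: sab; rewrite /= in_itv.
pose r := t0 - s0; pose h u := if u <= t0 then g u else g' (u - r).
have t0r : t0 = s0 + r by rewrite /r addrC subrK.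
(* A shift by 0, so that both pieces go through the same shift lemmas. *)
have h1 t : t \in `[a, t0] -> g t = h (t + 0).
  by rewrite in_itv/= addr0 /h => /andP[_ ->].
have h2 t : t \in `[s0, b'] -> g' t = h (t + r).
  rewrite in_itv/= /h => /andP[st _]; case: ifPn => [tt|]; last by rewrite addrK.
  have -> : t = s0 by apply/eqP; rewrite eq_le st andbT -(lerD2r r) -t0r.
  by rewrite gts t0r.
have q1 := qh_arc_sub qg (lexx a) at0 t0b.
have q2 := qh_arc_sub qg' as0 s0b (lexx b').
have [a1 _ r1] := q1; have [a2 _ r2] := q2.
have ah1 := arc_shift h1 a1; have ah2 := arc_shift h2 a2.
rewrite !addr0 in ah1; rewrite -t0r in ah2.
have [_ ch1 ih1] := ah1; have [t0d ch2 ih2] := ah2.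
have ad := le_trans at0 t0d.
have L1 := curve_length_shift h1; have L2 := curve_length_shift h2.
rewrite !addr0 in L1; rewrite -t0r in L2.
have ah : arc a (b' + r) h.
  split => //.
    have -> : `[a, b' + r]%classic = `[a, t0] `|` `[t0, b' + r].
      apply/seteqP; split => u /=; rewrite !in_itv/=.
        move=> /andP[-> ->]; rewrite andbT.
        by case: (leP u t0) => [|/ltW]; [left | right].
      by move=> [/andP[-> /le_trans->]|/andP[/(le_trans at0)-> ->]].
    by apply: withinU_continuous => //; exact: interval_closed.
  have key u v : a <= u -> u <= t0 -> t0 < v -> v <= b' + r -> h u <> h v.
    move=> au ut tv vd huv; have uab : u \in `[a, b].
      by rewrite in_itv/= au (le_trans ut).
    have vab : v - r \in `[a', b'].
      rewrite in_itv/= lerBlDr vd andbT (le_trans as0)// lerBrDr -t0r.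
      exact: ltW.
    move: huv; rewrite {1}/h ut /h leNgt tv /= => huv.
    move: ut; rewrite le_eqVlt => /predU1P[ut|ut].
      move: huv; rewrite ut -gts => /ig'; rewrite !inE => /(_ sab vab) e.
      by move: tv; rewrite t0r e subrK ltxx.
    by apply: (nF u uab ut); exists (v - r).
  move=> u v; rewrite !in_itv/= => /andP[au ud] /andP[av vd] huv.
  have [ut|tu] := leP u t0; have [vt|tv] := leP v t0.
  - by apply: ih1 => //; rewrite in_itv/= ?au ?av.
  - by case: (key u v).
  - by case: (key v u).
  - by apply: ih2 => //; rewrite in_itv/= ltW.
have rh : rectifiable a (b' + r) h.
  by rewrite /rectifiable (curve_lengthD h at0 t0d) -L1 -L2 lte_add_pinfty.
have hG : h @` `[a, b' + r] `<=` G.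
  move=> _ [u + <-]; rewrite /= in_itv/= => /andP[au ud].
  have [ut|tu] := leP u t0.
    rewrite -[u]addr0 -h1 ?in_itv/= ?au//; apply: (qh_arc_in qg).
    by rewrite in_itv/= au (le_trans ut).
  rewrite -[u](subrK r) -h2.
    apply: (qh_arc_in qg').
    by rewrite in_itv/= lerBrDr lerBlDr ud andbT (le_trans _ (ltW tu))// t0r lerD2r.
  by rewrite in_itv/= lerBrDr lerBlDr ud -t0r ltW.
exists a, (b' + r), h; split => //.
- by rewrite -[a]addr0 -h1 ?addr0// in_itv/= lexx.
- by rewrite -h2 // in_itv/= lexx andbT.
have E1 : qh_length G a t0 g = qh_length G a t0 h.
  exact: (qh_length_shift (esym (addr0 a)) (esym (addr0 t0)) a1 r1 ah1 h1).
have E2 : qh_length G s0 b' g' = qh_length G t0 (b' + r) h.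
  exact: (qh_length_shift t0r erefl a2 r2 ah2 h2).
rewrite (qh_lengthD (And3 ah hG rh) at0 t0d) -E1 -E2; apply: leeD.
  by rewrite (qh_lengthD qg at0 t0b) leeDl// qh_length_ge0.
by rewrite (qh_lengthD qg' as0 s0b) leeDr// qh_length_ge0.
Qed.

Lemma qh_dist_le a b (g : R -> X) : qh_arc a b g ->
  (qh_dist G (g a) (g b) <= qh_length G a b g)%E.
Proof. by move=> [ag gG rg]; apply: ereal_inf_lbound; exists a, b, g. Qed.

Lemma qh_dist_ge0 x y : (0 <= qh_dist G x y)%E.
Proof. by apply/ereal_infP => _ [a [b [g [_ _ _ ->]]]]; exact: qh_length_ge0. Qed.

Lemma qh_dist_triangle x y z :
  (qh_dist G x z <= qh_dist G x y + qh_dist G y z)%E.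
Proof.
have [xy|xy] := eqVneq (qh_dist G x y) +oo%E.
  by rewrite xy addye ?leey// gt_eqF// (lt_le_trans _ (qh_dist_ge0 _ _)).
have [yz|yz] := eqVneq (qh_dist G y z) +oo%E.
  by rewrite yz addey ?leey// gt_eqF// (lt_le_trans _ (qh_dist_ge0 _ _)).
have fin u v : qh_dist G u v != +oo%E -> qh_dist G u v \is a fin_num.
  by move=> uv; rewrite ge0_fin_numE ?qh_dist_ge0// ltey.
apply/lee_addgt0Pr => e e0; have e20 : 0 < e / 2 by rewrite divr_gt0.
have [_ [a [b [g [[ag ga gb] gG rg ->]]]] gl] :=
  lb_ereal_inf_adherent e20 (fin _ _ xy).
have [_ [a' [b' [g' [[ag' ga' gb'] gG' rg' ->]]]] gl'] :=
  lb_ereal_inf_adherent e20 (fin _ _ yz).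
have [|c [d [h [qh hc hd hl]]]] :=
  qh_arc_cat (And3 ag gG rg) (And3 ag' gG' rg').
  by rewrite gb ga'.
rewrite -ga -hc -gb' -hd; apply: le_trans (qh_dist_le qh) _.
apply: le_trans hl _; rewrite [e]splitr EFinD.
by rewrite [leRHS]addeACA; apply: leeD;
  [rewrite hc ga | rewrite hd gb']; exact: ltW.
Qed.

End qh_length.

(** * Domains in quasiconvex spaces *)

Section curves.
Context {R : realType} {X : metricType R}.
Implicit Types (g : R -> X) (G : set X).

Lemma closed_mdist_ge (p : X) r : closed [set z | r <= mdist p z].
Proof.
move=> z cz /=; rewrite leNgt; apply/negP => zr.
have e0 : 0 < r - mdist p z by rewrite subr_gt0.
have [w [/= rw]] := cz _ (nbhsx_ballx z (r - mdist p z) e0).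
rewrite ballEmdist/= => zw; have := metric_triangle p z w; lra.
Qed.

Lemma closed_mdist_le (p : X) r : closed [set z | mdist p z <= r].
Proof.
move=> z cz /=; rewrite leNgt; apply/negP => zr.
have e0 : 0 < mdist p z - r by rewrite subr_gt0.
have [w [/= rw]] := cz _ (nbhsx_ballx z (mdist p z - r) e0).
rewrite ballEmdist/= => zw; have := metric_triangle p w z.
rewrite (metric_sym w); lra.
Qed.

Lemma exit_ball a b g r t : {within `[a, b], continuous g} -> 0 <= r ->
  t \in `[a, b] -> r <= mdist (g a) (g t) ->
  exists t0, [/\ t0 \in `[a, b], t0 <= t, mdist (g a) (g t0) = r &
    forall s, s \in `[a, b] -> s <= t0 -> mdist (g a) (g s) <= r].
Proof.
move=> cg r0 tab rt.
have [t0 [t0ab t0t rt0 nt0]] := first_hit cg (@closed_mdist_ge (g a) r) tab rt.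
have le0 : mdist (g a) (g t0) <= r.
  have /andP[at0 _] : a <= t0 <= b by move: t0ab; rewrite in_itv.
  move: at0; rewrite le_eqVlt => /predU1P[<-|at0]; first by rewrite mdistxx.
  apply: (itv_cvg_left cg (@closed_mdist_le (g a) r) t0ab at0) => s sab st0.
  by rewrite /= leNgt; apply/negP => /ltW; exact: nt0.
exists t0; split => //; first by apply/eqP; rewrite eq_le le0.
move=> s sab; rewrite le_eqVlt => /predU1P[->//|st0].
by rewrite leNgt; apply/negP => /ltW; exact: nt0.
Qed.

Lemma exit_domain a b g G t : {within `[a, b], continuous g} -> open G ->
  t \in `[a, b] -> G (g a) -> ~ G (g t) ->
  exists t0, [/\ t0 \in `[a, b], a < t0, t0 <= t, boundary G (g t0) &
    forall s, s \in `[a, b] -> s < t0 -> G (g s)].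
Proof.
move=> cg oG tab Ga nGt.
have cG : closed (~` G) by exact: open_closedC.
have [t0 [t0ab t0t nG0 Gs]] := first_hit cg cG tab nGt.
have {}Gs s : s \in `[a, b] -> s < t0 -> G (g s).
  by move=> sab st0; apply: contrapT; exact: Gs.
have /andP[at0 _] : a <= t0 <= b by move: t0ab; rewrite in_itv.
have {}at0 : a < t0.
  rewrite lt_neqAle at0 andbT; apply/eqP => e; by rewrite -e in nG0.
exists t0; split => //; split; last by move=> /interior_subset.
apply: (itv_cvg_left cg (@closed_closure _ G) t0ab at0) => s sab st0.
by apply: subset_closure; exact: Gs.
Qed.

Lemma mdist_le_len_mid a b (g : R -> X) t : rectifiable a b g ->
  t \in `[a, b] -> mdist (g a) (g t) <= len g a b.
Proof.
rewrite in_itv/= => rg /andP[at_ tb].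
rewrite (lenD at_ tb rg) -[leLHS]addr0 lerD ?len_ge0// mdist_le_len//.
exact: rectifiable_sub rg _ _ _.
Qed.

End curves.

Section domain.
Context {R : realType} {X : metricType R}.
Variables (c : R) (G : set X).
Hypotheses (c1 : 1 <= c) (qX : quasiconvex X c).
Hypotheses (dG : domain G) (GX : G != setT).

Let oG : open G. Proof. by case: dG. Qed.
Let c0 : 0 < c. Proof. exact: lt_le_trans c1. Qed.

Lemma quasiconvex_arc x y : exists a b (g : R -> X),
  [/\ arc a b g, rectifiable a b g, g a = x, g b = y &
      len g a b <= c * mdist x y].
Proof.
have [a [b [g [[ag ga gb] gl]]]] := qX x y.
have rg : rectifiable a b g by apply: le_lt_trans gl (ltry _).
exists a, b, g; split => //.
by rewrite -lee_fin -lenE//; case: ag.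
Qed.

Lemma boundary_neq0 : boundary G !=set0.
Proof.
have [p Gp] : G !=set0 by case: dG.
have [q nGq] : exists q, ~ G q.
  by apply: contrapT => nq; move/eqP: GX; apply; apply/seteqP; split => // z _;
    apply: contrapT => nGz; apply: nq; exists z.
have [a [b [g [[ab cg _] _ ga gb _]]]] := quasiconvex_arc p q.
have bab : b \in `[a, b] by rewrite in_itv/= lexx andbT.
have [| |t0 [_ _ _ bt _]] := exit_domain cg oG bab; first by rewrite ga.
  by rewrite gb.
by exists (g t0).
Qed.
Let bG := boundary_neq0.

Lemma boundaryNin w : boundary G w -> ~ G w.
Proof. by move=> [_ nw] Gw; apply: nw; rewrite (interior_id G).1. Qed.

Lemma curve_stays a b (g : R -> X) : {within `[a, b], continuous g} ->
  G (g a) -> (forall t, t \in `[a, b] -> mdist (g a) (g t) < bdist G (g a)) ->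
  forall t, t \in `[a, b] -> G (g t).
Proof.
move=> cg Ga gd t tab; apply: contrapT => nGt.
have [t0 [t0ab _ _ bt _]] := exit_domain cg oG tab Ga nGt.
by have := gd _ t0ab; rewrite ltNge bdist_le.
Qed.

Lemma local_arc p q : G p -> c * mdist p q < bdist G p ->
  exists a b (g : R -> X),
  [/\ qh_arc G a b g, g a = p, g b = q & len g a b <= c * mdist p q].
Proof.
move=> Gp pq; have [a [b [g [ag rg ga gb gl]]]] := quasiconvex_arc p q.
exists a, b, g; split => //; split => // _ [t /= tab <-].
apply: (@curve_stays a b) tab; [by case: ag | by rewrite ga|].
move=> u uab; rewrite ga; apply: le_lt_trans pq; apply: le_trans gl.
by rewrite -ga mdist_le_len_mid.
Qed.

(** [bdist] is the distance to the boundary, not to the complement: a ball of radius delta(p) may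
    contain points outside G and yet miss the boundary. Dividing by c makes room for an arc from p
    to q, which would have to cross the boundary. *)
Lemma ball_in_domain p q : G p -> mdist p q < bdist G p / c -> G q.
Proof.
move=> Gp; rewrite ltr_pdivlMr// mulrC => pq.
have [a [b [g [qg _ <- _]]]] := local_arc Gp pq.
by apply: (qh_arc_in qg); case: qg => -[ab _ _] _ _; rewrite in_itv/= ab lexx.
Qed.

(** The joining arc has length at most delta(p) / 2, so delta is at least delta(p) / 2 on it; hence
    the factor 2. *)
Lemma qh_dist_local p q : G p -> 2 * c * mdist p q <= bdist G p ->
  (qh_dist G p q <= (2 * c * mdist p q / bdist G p)%:E)%E.
Proof.
move=> Gp pq; have p0 := bdist_gt0 bG oG Gp.
have pq' : c * mdist p q < bdist G p.
  have : 0 <= c * mdist p q by rewrite mulr_ge0 ?mdist_ge0// ltW.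
  lra.
have [a [b [g [qg ga gb gl]]]] := local_arc Gp pq'.
rewrite -{1}ga -{1}gb; apply: le_trans (qh_dist_le qg) _.
have [_ _ rg] := qg.
have M0 : 0 < bdist G p / 2 by rewrite divr_gt0.
apply: le_trans (qh_length_le oG bG qg M0 _) _.
  move=> t tab; have := mdist_le_len_mid rg tab; rewrite ga => pt.
  have := bdist_lipschitz bG p (g t).
  lra.
rewrite lee_fin ler_pdivrMr//.
by have -> : 2 * c * mdist p q / bdist G p * (bdist G p / 2) = c * mdist p q
  by field; rewrite gt_eqF.
Qed.

Lemma qh_dist_local_le1 p q : G p -> G q ->
  mdist p q <= bdist G p / (4 * c) \/ mdist p q <= bdist G q / (4 * c) ->
  (qh_dist G p q <= 1%:E)%E.
Proof.
move=> Gp Gq pq.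
have p0 := bdist_gt0 bG oG Gp; have q0 := bdist_gt0 bG oG Gq.
have d0 := mdist_ge0 p q.
have dc : mdist p q <= c * mdist p q by rewrite ler_peMl.
have {}pq : 2 * c * mdist p q <= bdist G p.
  case: pq; rewrite ler_pdivlMr ?mulr_gt0// mulrC -mulrA => pq.
    lra.
  have := bdist_lipschitz bG q p; rewrite metric_sym; lra.
apply: le_trans (qh_dist_local Gp pq) _.
by rewrite lee_fin ler_pdivrMr// mul1r.
Qed.

End domain.

Section complete.
Context {R : realType} {X : completeMetricType R}.

(** Completeness without sequences: the sets P d are a base of a Cauchy filter. No points
    approaching the boundary have to be chosen. *)
Lemma complete_limit (P : R -> set X) :
  (forall d, 0 < d -> P d !=set0) ->
  (forall d e, d <= e -> P d `<=` P e) ->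
  (forall e, 0 < e -> exists2 d, 0 < d &
     forall x y, P d x -> P d y -> mdist x y < e) ->
  exists l, forall e, 0 < e -> exists2 d, 0 < d &
     forall x, P d x -> mdist l x < e.
Proof.
move=> P0 Pm Pc; pose F := filter_from [set d : R | 0 < d] P.
have FF : ProperFilter F.
  apply: filter_from_proper => //; apply: filter_from_filter.
    by exists 1 => /=.
  move=> d e /= d0 e0; exists (Num.min d e); first by rewrite /= lt_min d0.
  by move=> x Px; split; apply: Pm Px; rewrite ge_min lexx ?orbT.
have cF : cauchy F.
  apply: cauchy_exP => e e0; have [d d0 dP] := Pc _ e0.
  have [x Px] := P0 _ d0; exists x; exists d => // y Py.
  by rewrite ballEmdist /=; exact: dP.
have Fl : cvg F by apply: cauchy_cvg.
exists (lim F) => e e0.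
have /metricType_numDomainType.fcvgrPdist_lt/(_ e e0)[d d0 dP] := Fl.
by exists d => // x /dP.
Qed.

End complete.

(** * From tame subarcs to cone arcs *)

Section cone.
Context {R : realType} {Y : metricType R}.
Implicit Types (phi : R -> Y) (d : R -> R) (a b : R).

Lemma first_reach a b d t s : {within `[a, b], continuous d} ->
  t \in `[a, b] -> d a <= s -> s <= d t ->
  exists t0, [/\ t0 \in `[a, b], t0 <= t, d t0 = s &
    forall u, u \in `[a, b] -> u <= t0 -> d u <= s].
Proof.
move=> cd tab das sdt.
have [t0 [t0ab t0t st0 nt0]] := first_hit cd (@closed_ge _ s) tab sdt.
have lt u : u \in `[a, b] -> u < t0 -> d u <= s.
  by move=> uab ut0; rewrite leNgt; apply/negP => /ltW; exact: nt0.
have le0 : d t0 <= s.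
  have /andP[at0 _] : a <= t0 <= b by move: t0ab; rewrite in_itv.
  move: at0; rewrite le_eqVlt => /predU1P[<-//|at0].
  by apply: (itv_cvg_left cd (@closed_le _ s) t0ab at0); exact: lt.
exists t0; split => //; first by apply/eqP; rewrite eq_le le0.
by move=> u uab; rewrite le_eqVlt => /predU1P[->//|]; exact: lt.
Qed.

Lemma reflect_continuous a b d : {within `[a, b], continuous d} ->
  {within `[- b, - a], continuous (d \o -%R)}.
Proof.
move=> /within_continuous_realP cd; apply/within_continuous_realP => t /= tab e e0.
have sub u : u \in `[- b, - a] -> - u \in `[a, b].
  by rewrite !in_itv/= => /andP[bu ua]; rewrite lerNr ua lerNl.
have [r r0 rP] := cd _ (sub _ tab) e e0; exists r => // s sab ts.
by apply: rP; [exact: sub | rewrite /ball/= -opprD normrN].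
Qed.

Lemma last_reach a b d t s : {within `[a, b], continuous d} ->
  t \in `[a, b] -> d b <= s -> s <= d t ->
  exists t0, [/\ t0 \in `[a, b], t <= t0, d t0 = s &
    forall u, u \in `[a, b] -> t0 <= u -> d u <= s].
Proof.
move=> cd tab das sdt.
have sub u : (- u \in `[- b, - a]) = (u \in `[a, b]).
  by rewrite !in_itv/= !lerN2 andbC.
have := @first_reach (- b) (- a) (d \o -%R) (- t) s (reflect_continuous cd).
rewrite sub /= !opprK => /(_ tab das sdt)[t0 [t0ab t0t dt0 ut0]].
exists (- t0); split; rewrite -?sub ?opprK//; first by rewrite lerNr.
by move=> u; rewrite -sub => uab tu; rewrite -[u]opprK ut0// lerNl.
Qed.

(** With phi the image arc and d its distance to the boundary of G', this is all that the cone
    estimate uses besides continuity and positivity of d. The lower bound on d serves to show that d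
    is almost increasing up to its maximum. *)
Definition tame phi d a b A B := forall v w s, a <= v -> v <= w -> w <= b ->
  0 < s -> s <= d v -> s <= d w ->
  (forall u, u \in `[v, w] -> d u <= A * s) ->
  forall u u', u \in `[v, w] -> u' \in `[v, w] ->
    mdist (phi u) (phi u') <= B * s /\ s <= B * d u.

Lemma reflect_tame phi d a b A B : tame phi d a b A B ->
  tame (phi \o -%R) (d \o -%R) (- b) (- a) A B.
Proof.
move=> td v w s bv vw wa s0 sv sw dA u u' uvw u'vw.
have sub x : x \in `[v, w] -> - x \in `[- w, - v].
  by rewrite !in_itv/= !lerN2 andbC.
apply: (td (- w) (- v) s) => //; rewrite ?lerN2//; [lra|lra| |exact: sub..].
move=> x; rewrite -[x]opprK; move: (- x) => {}x.
by rewrite in_itv/= !lerN2 andbC => xvw; rewrite dA// in_itv.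
Qed.

(** Tameness with A = 1 bounds d on [a, u] by S = C d(u). Going back from u, S is divided by 2C at
    each stage, and each stage has size at most C' S / (2C), so all of them together stay within 2
    C' S of phi u; two such distances give 4 C C' d(u). *)
Lemma tame_left phi d a b z C C' : 1 <= C -> 0 <= C' ->
  {within `[a, b], continuous d} -> (forall t, t \in `[a, b] -> 0 < d t) ->
  tame phi d a b 1 C -> tame phi d a b (2 * C) C' ->
  z \in `[a, b] -> (forall t, t \in `[a, b] -> d t <= d z) ->
  forall u t t', u \in `[a, z] -> t \in `[a, u] -> t' \in `[a, u] ->
    mdist (phi t) (phi t') <= 4 * C * C' * d u.
Proof.
move=> C1 C'0 cd d0 tC tC' zab dz.
have C0 : 0 < C by exact: lt_le_trans C1.
have /andP[az zb] : a <= z <= b by move: zab; rewrite in_itv.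
have sub x y u : a <= x -> y <= b -> u \in `[x, y] -> u \in `[a, b].
  rewrite !in_itv/= => ax yb /andP[xu uy].
  by rewrite (le_trans ax xu) (le_trans uy yb).
have csub x y : a <= x -> y <= b -> {within `[x, y], continuous d}.
  move=> ax yb; apply: continuous_subspaceW cd => u /=; exact: sub.
(* Tameness with A = 1 applies between the last time before u and the first
   time after u at which d = d v. *)
have before v u : a <= v -> v <= u -> u <= z -> d v <= C * d u.
  move=> av vu uz; have ub := le_trans uz zb; have au := le_trans av vu.
  have uab : u \in `[a, b] by rewrite in_itv/= au.
  have vab : v \in `[a, b] by rewrite in_itv/= av (le_trans vu).
  have [le|lt] := leP (d v) (d u).
    by apply: le_trans le _; rewrite ler_peMl// ltW// d0.
  have vvu : v \in `[v, u] by rewrite in_itv/= lexx.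
  have zuz : z \in `[u, z] by rewrite in_itv/= uz lexx.
  have [v1 [+ vv1 dv1 v1P]] :=
    last_reach (csub v u av ub) vvu (ltW lt) (lexx _).
  rewrite in_itv/= => /andP[_ v1u].
  have [w1 [+ w1z dw1 w1P]] :=
    first_reach (csub u z au zb) zuz (ltW lt) (dz _ vab).
  rewrite in_itv/= => /andP[uw1 _].
  have u1 : u \in `[v1, w1] by rewrite in_itv/= v1u.
  have [] := tC v1 w1 (d v) (le_trans av vv1) (le_trans v1u uw1)
    (le_trans w1z zb) (d0 _ vab) _ _ _ u u u1 u1; rewrite ?dv1 ?dw1//.
  move=> x; rewrite in_itv/= mul1r => /andP[v1x xw1].
  have [xu|ux] := leP x u.
    by apply: v1P => //; rewrite in_itv/= xu (le_trans vv1).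
  by apply: w1P => //; rewrite in_itv/= (ltW ux) (le_trans xw1).
have A2 : 2 <= 2 * C by rewrite ler_peMr.
have A0 : 0 < 2 * C by rewrite mulr_gt0.
(* n bounds the number of stages: each divides S by 2C, which is at least 2, and they stop once S is
   at most 2C d(a). *)
have descent n : forall u S, a <= u -> u <= b -> 0 < S ->
    (forall t, t \in `[a, u] -> d t <= S) -> S <= 2 * C * d u ->
    S <= 2 ^+ n * d a ->
    forall t, t \in `[a, u] -> mdist (phi t) (phi u) <= 2 * C' * S.
  have base u S : a <= u -> u <= b -> 0 < S ->
      (forall t, t \in `[a, u] -> d t <= S) -> S <= 2 * C * d u ->
      S <= 2 * C * d a ->
      forall t, t \in `[a, u] -> mdist (phi t) (phi u) <= 2 * C' * S.
    move=> au ub S0 dS Su Sa t tau.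
    have s0 : 0 < S / (2 * C) by rewrite divr_gt0.
    have uau : u \in `[a, u] by rewrite in_itv/= au lexx.
    have [] := tC' a u (S / (2 * C)) (lexx a) au ub s0 _ _ _ t u tau uau.
    - by rewrite ler_pdivrMr// mulrC.
    - by rewrite ler_pdivrMr// mulrC.
    - by move=> x xau; rewrite mulrC divfK ?gt_eqF//; exact: dS.
    move=> + _; move=> /le_trans; apply.
    rewrite mulrA ler_pdivrMr//; apply: (@le_trans _ _ (2 * C' * S * 1)).
      by have := mulr_ge0 C'0 (ltW S0); lra.
    apply: ler_wpM2l; last by lra.
    by rewrite !mulr_ge0// ltW.
  elim: n => [|n IH] u S au ub S0 dS Su Sa.
    apply: base => //; apply: le_trans Sa _; rewrite expr0 ler_pM2r ?d0//.
      by move: A2; lra.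
    by rewrite in_itv/= lexx (le_trans au).
  have aab : a \in `[a, b] by rewrite in_itv/= lexx (le_trans au).
  have [le|lt] := leP S (2 * C * d a); first exact: base.
  set s := S / (2 * C); have s0 : 0 < s by rewrite divr_gt0.
  have as_ : d a <= s by rewrite ler_pdivlMr// mulrC ltW.
  have su : s <= d u by rewrite ler_pdivrMr// mulrC.
  have uau : u \in `[a, u] by rewrite in_itv/= au lexx.
  (* Before t0 the values of d are at most s, which suits the induction; from t0 to u they are at
     most 2C s and at least s at both ends, which suits tameness. *)
  have [t0 [+ _ dt0 t0P]] := first_reach (csub a u (lexx a) ub) uau as_ su.
  rewrite in_itv/= => /andP[at0 t0u].
  have As : 2 * C * s = S by rewrite mulrC divfK// gt_eqF.
  have s2 : 2 * s <= S by rewrite -As ler_pM2r.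
  have t0t0 : t0 \in `[t0, u] by rewrite in_itv/= lexx.
  have ut0 : u \in `[t0, u] by rewrite in_itv/= t0u lexx.
  have last x : x \in `[t0, u] -> mdist (phi x) (phi u) <= C' * s.
    move=> xt0; have [] := tC' t0 u s at0 t0u ub s0 _ su _ x u xt0 ut0 => //.
      by rewrite dt0.
    move=> y; rewrite in_itv/= As => /andP[t0y yu]; apply: dS.
    by rewrite in_itv/= yu (le_trans at0).
  have cs : 0 <= C' * s by rewrite mulr_ge0// ltW.
  have c2 : 2 * (C' * s) <= C' * S by rewrite mulrCA ler_wpM2l.
  move=> t; rewrite in_itv/= => /andP[at_ tu].
  have [tt0|t0t] := leP t t0; last first.
    have tt : t \in `[t0, u] by rewrite in_itv/= tu ltW.
    by have := last t tt; lra.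
  have tat0 : t \in `[a, t0] by rewrite in_itv/= at_.
  have := IH t0 s at0 (le_trans t0u ub) s0 _ _ _ t tat0.
  have := metric_triangle (phi t) (phi t0) (phi u).
  have := last t0 t0t0.
  move=> h1 h2 h3; apply: le_trans h2 _.
  apply: (@le_trans _ _ (2 * C' * s + C' * s)); last by lra.
  apply: lerD => //; apply: h3.
  - move=> x; rewrite in_itv/= => /andP[ax xt0]; apply: t0P => //.
    by rewrite in_itv/= ax (le_trans xt0).
  - by rewrite dt0 ler_peMl ?ltW//; lra.
  - by move: Sa; rewrite exprS; lra.
move=> u t t'; rewrite in_itv/= => /andP[au uz] tau t'au.
have ub := le_trans uz zb.
have uab : u \in `[a, b] by rewrite in_itv/= au.
have aab : a \in `[a, b] by rewrite in_itv/= lexx (le_trans au).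
have S0 : 0 < C * d u by rewrite mulr_gt0// d0.
have [n nP] : exists n : nat, C * d u <= 2 ^+ n * d a.
  exists (Num.truncn (C * d u / d a)).+1; rewrite -ler_pdivrMr ?d0//.
  apply: le_trans (ltW (truncnS_gt _)) _.
  by rewrite -natrX ler_nat ltnW// ltn_expl.
have H x : x \in `[a, u] -> mdist (phi x) (phi u) <= 2 * C' * (C * d u).
  apply: (descent n) => //.
    by move=> y; rewrite in_itv/= => /andP[ay yu]; exact: before.
  by rewrite ler_pM2r ?d0//; lra.
have := metric_triangle (phi t) (phi u) (phi t').
have := H t tau; have := H t' t'au; rewrite (metric_sym (phi u)); lra.
Qed.

Lemma tame_right phi d a b z C C' : 1 <= C -> 0 <= C' ->
  {within `[a, b], continuous d} -> (forall t, t \in `[a, b] -> 0 < d t) ->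
  tame phi d a b 1 C -> tame phi d a b (2 * C) C' ->
  z \in `[a, b] -> (forall t, t \in `[a, b] -> d t <= d z) ->
  forall u t t', u \in `[z, b] -> t \in `[u, b] -> t' \in `[u, b] ->
    mdist (phi t) (phi t') <= 4 * C * C' * d u.
Proof.
move=> C1 C'0 cd d0 tC tC' zab dz u t t' uzb tub t'ub.
have sub (x y w : R) : (- w \in `[- y, - x]) = (w \in `[x, y]).
  by rewrite !in_itv/= !lerN2 andbC.
have sub' (x y w : R) : (w \in `[- y, - x]) -> - w \in `[x, y].
  by rewrite -[w in X in X -> _]opprK sub.
have := @tame_left (phi \o -%R) (d \o -%R) (- b) (- a) (- z) C C' C1 C'0
  (reflect_continuous cd) _ (reflect_tame tC) (reflect_tame tC') _ _
  (- u) (- t) (- t'); rewrite /= !opprK !sub; apply => //.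
- by move=> w /sub'; exact: d0.
- by move=> w /sub' /dz.
Qed.

End cone.

(** * Weakly quasisymmetric maps onto uniform domains *)

Section growth.
Context {R : realType}.

Lemma natr_bound (x y : R) : 0 < y -> exists n : nat, x <= n%:R * y.
Proof.
move=> y0; exists (Num.truncn (Num.max 0 x / y)).+1.
have := truncnS_gt (Num.max 0 x / y); rewrite ltr_pdivrMr//.
by move=> /ltW; apply: le_trans; rewrite le_max lexx orbT.
Qed.

Lemma bernoulli_ineq (t : R) n : 0 <= t -> 1 + n%:R * t <= (1 + t) ^+ n.
Proof.
move=> t0; elim: n => [|n IH]; first by rewrite mul0r addr0 expr0.
rewrite exprS; apply: (@le_trans _ _ ((1 + t) * (1 + n%:R * t))).
  have : 0 <= n%:R * t * t by rewrite !mulr_ge0.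
  rewrite -natr1; lra.
by rewrite ler_pM2l// ltr_pwDl.
Qed.

(** Bernoulli's inequality is only linear; squared at the half m of n it gives the quadratic bound
    (m t)^2. The 3 P comes from n <= 2 m + 1 <= 3 m. *)
Lemma linear_le_geometric (t P Q : R) : 0 < t -> 0 <= P -> 0 <= Q ->
  exists N : nat, forall n, (N <= n)%N -> P * n%:R + Q <= (1 + t) ^+ n * t.
Proof.
move=> t0 P0 Q0; have t30 : 0 < t ^+ 3 by rewrite exprn_gt0.
have [m0 m0P] := natr_bound (3 * P + Q) t30.
exists (m0.+1).*2 => n Nn; pose m := n./2.
have m0m : (m0 < m)%N by rewrite /m -[m0.+1]doubleK half_leq.
have nm : n%:R <= 2 * m%:R + 1 :> R.
  rewrite -{1}[n]odd_double_half -/m natrD -muln2 natrM addrC mulrC lerD2l.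
  by case: (odd n); rewrite ?ler01.
have m1 : 1 <= m%:R :> R by rewrite ler1n (leq_ltn_trans _ m0m).
have mm : m0%:R <= m%:R :> R by rewrite ler_nat ltnW.
have mt : 0 <= m%:R * t by rewrite mulr_ge0// ltW.
have B := bernoulli_ineq m (ltW t0).
have E : (1 + t) ^+ m.*2 <= (1 + t) ^+ n.
  by rewrite ler_weXn2l ?lerDl ?(ltW t0)// -[leqRHS]odd_double_half leq_addl.
have S : (m%:R * t) ^+ 2 <= (1 + t) ^+ m.*2.
  rewrite -muln2 exprM ler_pXn2r ?nnegrE//; [|by rewrite exprn_ge0// addr_ge0 ?ltW].
  by apply: le_trans B; rewrite lerDr.
apply: (@le_trans _ _ ((m%:R * t) ^+ 2 * t)); last first.
  by rewrite ler_pM2r//; exact: le_trans S E.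
have -> : (m%:R * t) ^+ 2 * t = m%:R * (m%:R * t ^+ 3) by ring.
apply: (@le_trans _ _ (m%:R * (3 * P + Q))).
  have h1 : P * n%:R <= P * (2 * m%:R + 1) by rewrite ler_wpM2l.
  have h2 : P <= P * m%:R by rewrite ler_peMr.
  have h3 : Q <= Q * m%:R by rewrite ler_peMr.
  lra.
rewrite ler_wpM2l//; apply: le_trans m0P _.
by rewrite ler_pM2r.
Qed.

End growth.

Section weakly_quasisymmetric_maps.
Context {R : realType} {X Y : completeMetricType R}.
Variables (c H b : R) (G : set X) (G' : set Y) (f : X -> Y) (h : Y -> X).
Hypotheses (c1 : 1 <= c) (H1 : 1 <= H) (b1 : 1 <= b).
Hypotheses (qX : quasiconvex X c) (qY : quasiconvex Y c).
Hypotheses (dG : domain G) (GX : G != setT).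
Hypotheses (dG' : domain G') (GY : G' != setT).
Hypothesis fG : forall x, G x -> G' (f x).
Hypothesis fS : forall y, G' y -> exists2 x, G x & f x = y.
Hypothesis fK : forall x, G x -> h (f x) = x.
Hypothesis cf : {within G, continuous f}.
Hypothesis ch : {within G', continuous h}.
Hypothesis wf : weakly_quasisymmetric H G f.
Hypothesis uG' : uniform_domain b G'.

Let c0 : 0 < c. Proof. exact: lt_le_trans c1. Qed.
Let H0 : 0 < H. Proof. exact: lt_le_trans H1. Qed.
Let b0 : 0 < b. Proof. exact: lt_le_trans b1. Qed.
Let oG : open G. Proof. by case: dG. Qed.
Let oG' : open G'. Proof. by case: dG'. Qed.
Let bG : boundary G !=set0. Proof. exact: boundary_neq0 qX dG GX. Qed.
Let bG' : boundary G' !=set0. Proof. exact: boundary_neq0 qY dG' GY. Qed.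

Lemma inverse_in y : G' y -> G (h y).
Proof. by move=> /fS[x Gx <-]; rewrite fK. Qed.

Lemma inverseK y : G' y -> f (h y) = y.
Proof. by move=> /fS[x Gx <-]; rewrite fK. Qed.

(** Consecutive points at distance at most |p - q| / 2: each is at least that far from p or from q,
    so the next image step is at most H times its image distance to f p or f q. The induction
    carries the extra term |f p - f q|, so that the sum grows by the factor 1 + H. *)
Lemma wqs_chain p q a d (g : R -> X) n t : G p -> G q -> qh_arc G a d g ->
  g a = p -> t \in `[a, d] -> len g a t <= n%:R * (mdist p q / 2) ->
  mdist (f p) (f (g t)) <= (1 + H) ^+ n * mdist (f p) (f q).
Proof.
move=> Gp Gq qg ga tad gl; have [[ad cg _] gG rg] := qg.
suff : mdist (f p) (f (g t)) + mdist (f p) (f q) <=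
    (1 + H) ^+ n * mdist (f p) (f q).
  by apply: le_trans; rewrite lerDl mdist_ge0.
elim: n t tad gl => [|n IH] t tad gl.
  have /andP[at_ td] : a <= t <= d by move: tad; rewrite in_itv.
  have /mdist_positivity <- : mdist p (g t) = 0; last first.
    by rewrite mdistxx add0r expr0 mul1r.
  apply/eqP; rewrite eq_le mdist_ge0 andbT; move: gl; rewrite mul0r.
  apply: le_trans; rewrite -ga mdist_le_len//; exact: rectifiable_sub rg _ _ _.
have /andP[at_ td] : a <= t <= d by move: tad; rewrite in_itv.
set s := mdist p q / 2 in IH gl.
have s0 : 0 <= s by rewrite divr_ge0 ?mdist_ge0.
have rt := rectifiable_sub rg (lexx a) at_ td.
have [[_ ct _] _ _] := qh_arc_sub qg (lexx a) at_ td.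
pose v := Num.min (len g a t) (n%:R * s).
have v0 : 0 <= v by rewrite le_min len_ge0//= mulr_ge0.
have vt : v <= len g a t by rewrite ge_min lexx.
have [t1 t1at t1v] := len_IVT at_ ct rt v0 vt.
have /andP[at1 t1t] : a <= t1 <= t by move: t1at; rewrite in_itv.
have t1ad : t1 \in `[a, d] by rewrite in_itv/= at1 (le_trans t1t).
have := IH t1 t1ad; rewrite t1v ge_min lexx orbT => /(_ isT) IH1.
have st : mdist (g t1) (g t) <= s.
  apply: le_trans (mdist_le_len t1t (rectifiable_sub rt at1 t1t (lexx t))) _.
  have := lenD at1 t1t rt; rewrite t1v /v.
  have [h1|h1] := leP (len g a t) (n%:R * s); first by lra.
  by move: gl; rewrite -natr1 mulrDl mul1r; lra.
have Gt1 := qh_arc_in qg t1ad; have Gt := qh_arc_in qg tad.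
have tri := metric_triangle p (g t1) q; rewrite -/s in tri.
have fp := mdist_ge0 (f p) (f q).
have step : mdist (f (g t1)) (f (g t)) <=
    H * (mdist (f p) (f (g t1)) + mdist (f p) (f q)).
  have [le_s|lt_s] := leP s (mdist (g t1) p).
    apply: le_trans (wf Gt1 Gt Gp (le_trans st le_s)) _.
    by rewrite ler_pM2l// metric_sym lerDl.
  have le_s : s <= mdist (g t1) q.
    have : mdist p q = s + s by rewrite /s -splitr.
    by move: lt_s tri; rewrite (metric_sym (g t1) p); lra.
  apply: le_trans (wf Gt1 Gt Gq (le_trans st le_s)) _.
  by rewrite ler_pM2l// [X in _ <= X + _]metric_sym metric_triangle.
have tri' := metric_triangle (f p) (f (g t1)) (f (g t)).
rewrite exprS -mulrA.
apply: (@le_trans _ _ ((1 + H) * (mdist (f p) (f (g t1)) + mdist (f p) (f q)))).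
  by rewrite mulrDl mul1r; lra.
by rewrite ler_pM2l// addr_gt0.
Qed.

(** If a step in G were longer than both distances of its starting point to p and q, then f p and f
    q would both lie within |f p - f q| / 3 of its image, against the triangle inequality. This is
    where the spacing |f p - f q| / (3 H) comes from. *)
Lemma wqs_inverse_chain p q a d (g : R -> Y) n t : G p -> G q ->
  qh_arc G' a d g -> g a = f p -> t \in `[a, d] ->
  len g a t <= n%:R * (mdist (f p) (f q) / (3 * H)) ->
  mdist p (h (g t)) <= 2 ^+ n * mdist p q.
Proof.
move=> Gp Gq qg ga tad gl; have [[ad cg _] gG rg] := qg.
suff : mdist p (h (g t)) + mdist p q <= 2 ^+ n * mdist p q.
  by apply: le_trans; rewrite lerDl mdist_ge0.
elim: n t tad gl => [|n IH] t tad gl.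
  have /andP[at_ td] : a <= t <= d by move: tad; rewrite in_itv.
  have /mdist_positivity <- : mdist (f p) (g t) = 0; last first.
    by rewrite fK// mdistxx add0r expr0 mul1r.
  apply/eqP; rewrite eq_le mdist_ge0 andbT; move: gl; rewrite mul0r.
  apply: le_trans; rewrite -ga mdist_le_len//; exact: rectifiable_sub rg _ _ _.
have /andP[at_ td] : a <= t <= d by move: tad; rewrite in_itv.
set s := mdist (f p) (f q) / (3 * H) in IH gl.
have s0 : 0 <= s by rewrite divr_ge0 ?mdist_ge0// mulr_ge0// ltW.
have rt := rectifiable_sub rg (lexx a) at_ td.
have [[_ ct _] _ _] := qh_arc_sub qg (lexx a) at_ td.
pose v := Num.min (len g a t) (n%:R * s).
have v0 : 0 <= v by rewrite le_min len_ge0//= mulr_ge0.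
have vt : v <= len g a t by rewrite ge_min lexx.
have [t1 t1at t1v] := len_IVT at_ ct rt v0 vt.
have /andP[at1 t1t] : a <= t1 <= t by move: t1at; rewrite in_itv.
have t1ad : t1 \in `[a, d] by rewrite in_itv/= at1 (le_trans t1t).
have := IH t1 t1ad; rewrite t1v ge_min lexx orbT => /(_ isT) IH1.
have st : mdist (g t1) (g t) <= s.
  apply: le_trans (mdist_le_len t1t (rectifiable_sub rt at1 t1t (lexx t))) _.
  have := lenD at1 t1t rt; rewrite t1v /v.
  have [h1|h1] := leP (len g a t) (n%:R * s); first by lra.
  by move: gl; rewrite -natr1 mulrDl mul1r; lra.
have Gt1 := qh_arc_in qg t1ad; have Gt := qh_arc_in qg tad.
have hG1 := inverse_in Gt1; have hGt := inverse_in Gt.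
have step : mdist (h (g t1)) (h (g t)) <=
    mdist p (h (g t1)) + mdist p q.
  rewrite leNgt; apply/negP => lt.
  have h0 := mdist_ge0 p (h (g t1)); have h1 := mdist_ge0 p q.
  have lp : mdist (h (g t1)) p <= mdist (h (g t1)) (h (g t)).
    rewrite metric_sym; lra.
  have lq : mdist (h (g t1)) q <= mdist (h (g t1)) (h (g t)).
    have := metric_triangle (h (g t1)) p q; rewrite (metric_sym _ p); lra.
  have := wf hG1 Gp hGt lp; have := wf hG1 Gq hGt lq.
  rewrite !inverseK// => dq dp.
  have Hs : H * mdist (g t1) (g t) <= mdist (f p) (f q) / 3.
    apply: (@le_trans _ _ (H * s)); first by rewrite ler_pM2l.
    by rewrite /s le_eqVlt; apply/orP; left; apply/eqP; field; rewrite gt_eqF.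
  have := metric_triangle (f p) (g t1) (f q).
  rewrite (metric_sym (f p) (g t1)) => tri.
  have d0 := mdist_ge0 (f p) (f q).
  have D0 : mdist (f p) (f q) = 0 by lra.
  have /mdist_positivity e : mdist (g t1) (g t) = 0.
    apply/eqP; rewrite eq_le mdist_ge0 andbT; move: st.
    by rewrite /s D0 mul0r.
  by move: lt h0; rewrite e mdistxx; lra.
have tri' := metric_triangle p (h (g t1)) (h (g t)).
rewrite exprS -mulrA; lra.
Qed.

Let K0 n : 0 < (1 + H) ^+ n. Proof. by rewrite exprn_gt0// addr_gt0. Qed.
Let K1 n : 1 <= (1 + H) ^+ n.
Proof. by rewrite exprn_ege1// lerDl ltW. Qed.

(* If it failed, points of G tending to a nearest boundary point of G' would
   stay near u, form a Cauchy family by [wqs_chain], and converge inside G. *)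
Lemma wqs_bdist u v : G u -> G v -> mdist u v <= bdist G u / (4 * c) ->
  mdist (f u) (f v) <= 3 * H * bdist G' (f u).
Proof.
move=> Gu Gv uv; rewrite leNgt; apply/negP => fuv.
have k0 := bdist_gt0 bG' oG' (fG Gu); set k := bdist G' (f u) in k0 fuv.
have u0 := bdist_gt0 bG oG Gu.
have [w bw fuw] := bdist_adherent bG' (f u) k0; rewrite -/k in fuw.
have nG'w := boundaryNin dG' bw.
pose P e := [set z | G z /\ mdist (f z) w < Num.min e k].
have Pk e z : P e z -> [/\ G z, mdist (f z) w < e & mdist (f z) w < k].
  by move=> [Gz]; rewrite lt_min => /andP[].
(* f u is within 2 k of w and f z within k, so |f u - f z| < 3 k. If z were farther from u than v
   is, |f u - f v| would be less than 3 H k. *)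
have Pu e z : P e z -> mdist u z <= bdist G u / (4 * c).
  move=> /Pk[Gz _ zk]; apply: le_trans uv; rewrite leNgt; apply/negP => uz.
  have := wf Gu Gv Gz (ltW uz); rewrite leNgt => /negP; apply.
  apply: le_lt_trans fuv; rewrite mulrAC [3 * k * H]mulrC ler_pM2l//.
  have := metric_triangle (f u) w (f z); rewrite (metric_sym w); lra.
have [| | |l lP] := @complete_limit _ _ P.
- move=> e e0; have ek : 0 < Num.min e k by rewrite lt_min e0.
  have [cw _] := bw; have [y [G'y]] := cw _ (nbhsx_ballx w _ ek).
  rewrite ballEmdist/= => wy; exists (h y); split; first exact: inverse_in.
  by rewrite inverseK// metric_sym.
- move=> d e de z /Pk[Gz zd zk]; split => //.
  by rewrite lt_min zk (lt_le_trans zd de).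
- move=> r r0; have r20 : 0 < r / 2 by rewrite divr_gt0.
  have [n nP] := natr_bound (bdist G u) r20.
  (* If y and z were r apart, a chain of n steps from y to u would give |f y - f u| < k / 2,
     although f y is within k / 4 of w, which is at distance at least k from f u. *)
  exists (k / (4 * (1 + H) ^+ n)); first by rewrite divr_gt0// mulr_gt0.
  set e := k / _ => y z Py Pz; rewrite ltNge; apply/negP => ryz.
  have [Gy ye yk] := Pk _ _ Py; have [Gz ze zk] := Pk _ _ Pz.
  have uy := Pu _ _ Py.
  have cuy : c * mdist y u <= bdist G u / 4.
    move: uy; rewrite metric_sym ler_pdivlMr ?mulr_gt0// ler_pdivlMr//; lra.
  have yu : c * mdist y u < bdist G y.
    have := bdist_lipschitz bG u y; rewrite metric_sym.
    have : mdist y u <= c * mdist y u by rewrite ler_peMl ?mdist_ge0.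
    lra.
  have [a [d [g [qg ga gd gl]]]] := local_arc qX dG GX Gy yu.
  have dad : d \in `[a, d] by case: qg => -[ad _ _] _ _; rewrite in_itv/= ad lexx.
  have ln : len g a d <= n%:R * (mdist y z / 2).
    apply: le_trans gl _; apply: le_trans cuy _.
    apply: (@le_trans _ _ (n%:R * (r / 2))); first by lra.
    by rewrite ler_wpM2l// ler_pM2r.
  have := wqs_chain Gy Gz qg ga dad ln; rewrite gd => chain.
  have yz2 : mdist (f y) (f z) < 2 * e.
    by have := metric_triangle (f y) w (f z); rewrite (metric_sym w); lra.
  have ky : k <= mdist (f u) (f y) + mdist (f y) w.
    exact: le_trans (bdist_le bG' _ bw) (metric_triangle _ _ _).
  have eK : (1 + H) ^+ n * e = k / 4.
    by rewrite /e; field; rewrite gt_eqF.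
  have ek : e <= k / 4.
    by rewrite -eK ler_peMl// ltW// divr_gt0// mulr_gt0.
  have : (1 + H) ^+ n * mdist (f y) (f z) <= 2 * (k / 4).
    by rewrite -eK mulrCA ler_pM2l// ltW.
  move: ky; rewrite metric_sym; lra.
have Gl : G l.
  have e0 : 0 < bdist G u / (4 * c) by rewrite divr_gt0// mulr_gt0.
  apply: (ball_in_domain c1 qX dG GX Gu).
  have [d d0 dP] := lP _ e0; have [z Pz] : P d !=set0.
    have ek : 0 < Num.min d k by rewrite lt_min d0.
    have [cw _] := bw; have [y [G'y]] := cw _ (nbhsx_ballx w _ ek).
    rewrite ballEmdist/= => wy; exists (h y); split; first exact: inverse_in.
    by rewrite inverseK// metric_sym.
  have := metric_triangle u z l; rewrite (metric_sym z).
  have := dP _ Pz; have := Pu _ _ Pz.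
  have -> : bdist G u / c = 4 * (bdist G u / (4 * c)) by field; rewrite gt_eqF.
  lra.
have lw0 : 0 < mdist (f l) w.
  by rewrite mdist_gt0; apply/eqP => e; apply: nG'w; rewrite -e; exact: fG.
have e0 : 0 < mdist (f l) w / 2 by rewrite divr_gt0.
have /within_continuous_mdistP/(_ _ Gl _ e0)[d1 d10 d1P] := cf.
have [d2 d20 d2P] := lP _ d10.
pose d := Num.min (Num.min d2 k) (mdist (f l) w / 2).
have dk : 0 < d by rewrite !lt_min d20 k0.
have [cw _] := bw; have [y [G'y]] := cw _ (nbhsx_ballx w _ dk).
rewrite ballEmdist/= !lt_min => /andP[/andP[y1 y2] y3].
have Gy := inverse_in G'y.
have Py : P d2 (h y) by split => //; rewrite inverseK// lt_min metric_sym y1.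
have := d1P _ Gy; rewrite ballEmdist/= inverseK// => /(_ (d2P _ Py)).
have := metric_triangle (f l) y w; rewrite (metric_sym y); lra.
Qed.

Lemma uniform_arc u v : G' u -> G' v -> exists a d (g : R -> Y),
  [/\ qh_arc G' a d g, g a = u, g d = v, len g a d <= b * mdist u v &
    forall t, t \in `[a, d] ->
      Num.min (len g a t) (len g t d) <= b * bdist G' (g t)].
Proof.
move=> Gu Gv; have [a [d [g [[[ag ga gd] gG] rg gm gl]]]] := uG' Gu Gv.
have ad : a <= d by case: ag.
exists a, d, g; split => //; first by rewrite -lee_fin -lenE.
move=> t tad; have := gm t tad.
have /andP[at_ td] : a <= t <= d by move: tad; rewrite in_itv.
rewrite !lenE//; [|exact: rectifiable_sub rg _ _ _..].
by rewrite -EFin_min lee_fin.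
Qed.

(* If f moved p less than this, it would keep a whole arc from p to the boundary
   of G inside a ball of G'; the images would converge in G', and so would the
   arc in G. *)
Lemma wqs_far_point mu n p : 0 < mu -> mu <= 2^-1 -> 4 * c <= n%:R * mu ->
  G p -> exists q, [/\ G q, mdist p q = mu * bdist G p &
    bdist G' (f p) <= 2 * c * (1 + H) ^+ n * mdist (f p) (f q)].
Proof.
move=> mu0 mu2 nmu Gp.
have p0 := bdist_gt0 bG oG Gp; have k0 := bdist_gt0 bG' oG' (fG Gp).
set k := bdist G' (f p) in k0 *; set D := bdist G p in p0 *.
have [w bw pw] := bdist_adherent bG p p0; rewrite -/D in pw.
have [a [d [g [[ad cg ig] rg ga gd gl]]]] := quasiconvex_arc qX p w.
have dad : d \in `[a, d] by rewrite in_itv/= ad lexx.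
have [||t0 [t0ad at0 t0d bt0 Gt]] := exit_domain cg oG dad; first by rewrite ga.
  by rewrite gd; exact: boundaryNin bw.
have D0 : D <= mdist p (g t0) by exact: bdist_le.
have muD : mu * D < D by rewrite -[ltRHS]mul1r ltr_pM2r//; lra.
have muD0 : 0 <= mu * D by rewrite mulr_ge0// ltW.
have /= := @exit_ball _ _ _ _ _ _ t0 cg muD0 t0ad; rewrite ga.
move=> /(_ (le_trans (ltW muD) D0))[tq [tqad tqt0 pq _]].
have {}tqt0 : tq < t0.
  rewrite lt_neqAle tqt0 andbT; apply/eqP => e.
  by move: pq D0 muD; rewrite e => ->; rewrite leNgt => /negP.
have Gq := Gt _ tqad tqt0; exists (g tq); split => //.
rewrite leNgt; apply/negP => kq; set q := g tq in pq Gq kq.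
have qa t : t \in `[a, d] -> t < t0 -> qh_arc G a t g.
  move=> tad tt0; have /andP[at_ td] : a <= t <= d by move: tad; rewrite in_itv.
  have sub : `[a, t] `<=` `[a, d] by apply: subset_itvl; rewrite bnd_simp.
  split; last exact: rectifiable_sub rg _ _ _.
    split => //; first exact: continuous_subspaceW cg.
    by move=> u v us vs; exact: (ig u v (sub u us) (sub v vs)).
  move=> _ [u uat <-]; apply: Gt; first exact: sub.
  by move: uat; rewrite /= in_itv/= => /andP[_ /le_lt_trans]; exact.
have near_p t : t \in `[a, d] -> t < t0 -> mdist (f p) (f (g t)) <= k / (2 * c).
  move=> tad tt0; have /andP[at_ td] : a <= t <= d by move: tad; rewrite in_itv.
  have tat : t \in `[a, t] by rewrite in_itv/= at_ lexx.
  (* The arc has length at most 2 c D, that is 4 c times D / 2, and a step |p - q| / 2 is mu D / 2;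
     hence the condition 4 c <= n mu. *)
  have ln : len g a t <= n%:R * (mdist p q / 2).
    apply: le_trans (len_homo rg at_ td (lexx d)) _; apply: le_trans gl _.
    rewrite pq; apply: (@le_trans _ _ (c * (2 * D))).
      by rewrite ler_pM2l//; lra.
    have -> : n%:R * (mu * D / 2) = n%:R * mu * (D / 2) by field.
    have -> : c * (2 * D) = 4 * c * (D / 2) by field.
    by rewrite ler_pM2r// divr_gt0.
  apply: le_trans (wqs_chain Gp Gq (qa t tad tt0) ga tat ln) _.
  by rewrite ler_pdivlMr ?mulr_gt0// [leLHS]mulrC mulrA ltW.
pose P e := [set y | exists2 t,
  [/\ t \in `[a, d], t < t0 & mdist (g t) (g t0) < e] & y = f (g t)].
have P0 e : 0 < e -> P e !=set0.
  move=> e0; move/itv_continuousP : (cg) => /(_ _ t0ad _ e0)[r r0 rP].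
  pose t := Num.max a (t0 - r / 2).
  have tt0 : t < t0 by rewrite gt_max at0/= gtrBl divr_gt0.
  have at_ : a <= t by rewrite le_max lexx.
  have tad : t \in `[a, d] by rewrite in_itv/= at_ (le_trans (ltW tt0)).
  exists (f (g t)), t => //; split => //; rewrite metric_sym; apply: rP => //.
  rewrite ger0_norm ?subr_ge0 ?(ltW tt0)//.
  rewrite ltrBlDr -ltrBlDl lt_max; apply/orP; right.
  by rewrite ltrD2l ltrN2 ltr_pdivrMr// ltr_pMr// ltr1n.
have [| | |l lP] := @complete_limit _ _ P.
- exact: P0.
- by move=> e e' ee' y [t [tad tt0 te] ->]; exists t => //; split => //;
    exact: lt_le_trans te ee'.
- move=> r r0; have r30 : 0 < r / (3 * H) by rewrite divr_gt0// mulr_gt0.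
  have [m mP] := natr_bound (b * k) r30.
  have M0 : 0 < 2 ^+ m :> R by rewrite exprn_gt0.
  have M1 : 1 <= 2 ^+ m :> R by rewrite exprn_ege1// ler1n.
  (* If the images were r apart, a chain along a uniform arc from f (g t) to f p would put g t
     within D / 2 of p, although g t is within D / 4 of the boundary point g t0. *)
  exists (D / (4 * 2 ^+ m)); first by rewrite divr_gt0// mulr_gt0.
  set e := D / _; move=> _ _ [t [tad tt0 te] ->] [s [sad st0 se] ->].
  rewrite ltNge; apply/negP => rts.
  have Gts := Gt _ tad tt0; have Gss := Gt _ sad st0.
  have [a' [d' [g' [qg' ga' gd' gl' _]]]] := uniform_arc (fG Gts) (fG Gp).
  have dad' : d' \in `[a', d'].
    by case: qg' => -[ad' _ _] _ _; rewrite in_itv/= ad' lexx.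
  have ln : len g' a' d' <= m%:R * (mdist (f (g t)) (f (g s)) / (3 * H)).
    apply: le_trans gl' _; apply: (@le_trans _ _ (b * k)).
      rewrite ler_pM2l// metric_sym; apply: le_trans (near_p _ tad tt0) _.
      rewrite ler_pdivrMr ?mulr_gt0//; have c21 : 1 <= 2 * c.
        by rewrite (le_trans c1)// ler_peMl ?ler1n// ltW.
      by have := ler_wpM2l (ltW k0) c21; rewrite mulr1.
    apply: le_trans mP _; rewrite ler_wpM2l// ler_pM2r// invr_gt0 mulr_gt0//.
  have := wqs_inverse_chain Gts Gss qg' ga' dad' ln; rewrite gd' fK// => chain.
  have ts2 : mdist (g t) (g s) < 2 * e.
    have := metric_triangle (g t) (g t0) (g s); rewrite (metric_sym (g t0) (g s)).
    lra.
  have tri := metric_triangle p (g t) (g t0).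
  have eM : 2 ^+ m * e = D / 4 by rewrite /e; field; rewrite gt_eqF.
  have eD : e <= D / 4 by rewrite -eM ler_peMl// ltW// divr_gt0// mulr_gt0.
  have : 2 ^+ m * mdist (g t) (g s) <= 2 * (D / 4).
    by rewrite -eM mulrCA ler_pM2l// ltW.
  move: tri; rewrite (metric_sym p (g t)); lra.
have Gl : G' l.
  have e0 : 0 < k / (2 * c) by rewrite divr_gt0// mulr_gt0.
  apply: (ball_in_domain c1 qY dG' GY (fG Gp)).
  have [r r0 rP] := lP _ e0; have [y Py] := P0 _ r0.
  have := rP _ Py; case: Py => t [tad tt0 _] -> ly.
  have := metric_triangle (f p) (f (g t)) l; rewrite (metric_sym (f (g t)) l).
  have := near_p _ tad tt0; rewrite -/k.
  have -> : k / c = 2 * (k / (2 * c)) by field; rewrite gt_eqF.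
  lra.
have lw0 : 0 < mdist (h l) (g t0).
  rewrite mdist_gt0; apply/eqP => e; apply: (boundaryNin dG bt0); rewrite -e.
  exact: inverse_in.
have e0 : 0 < mdist (h l) (g t0) / 2 by rewrite divr_gt0.
have /within_continuous_mdistP/(_ _ Gl _ e0)[d1 d10 d1P] := ch.
have [d2 d20 d2P] := lP _ d10.
have dk : 0 < Num.min d2 (mdist (h l) (g t0) / 2) by rewrite lt_min d20.
have [_ [t [tad tt0 +] _]] := P0 _ dk; rewrite lt_min => /andP[t1 t2].
have Py : P d2 (f (g t)) by exists t.
have Gtt := Gt _ tad tt0.
have := d1P _ (fG Gtt); rewrite ballEmdist/= fK// => /(_ (d2P _ Py)).
have := metric_triangle (h l) (g t) (g t0); lra.
Qed.

(** If q were farther from p than the point given by [wqs_far_point], weak quasisymmetry would bound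
    delta'(f p) by half of the left-hand side of the last hypothesis. *)
Lemma wqs_inverse_local mu n p q : 0 < mu -> mu <= 2^-1 ->
  4 * c <= n%:R * mu -> G p -> G q ->
  4 * c * H * (1 + H) ^+ n * mdist (f p) (f q) <= bdist G' (f p) ->
  mdist p q <= mu * bdist G p.
Proof.
move=> mu0 mu2 nmu Gp Gq pq; have k0 := bdist_gt0 bG' oG' (fG Gp).
have [a [Ga <- pa]] := wqs_far_point mu0 mu2 nmu Gp.
rewrite leNgt; apply/negP => lt; have := wf Gp Ga Gq (ltW lt) => ww.
have : bdist G' (f p) <= 2 * c * (1 + H) ^+ n * (H * mdist (f p) (f q)).
  by apply: le_trans pa _; rewrite ler_pM2l// !mulr_gt0.
have -> : 2 * c * (1 + H) ^+ n * (H * mdist (f p) (f q)) =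
  4 * c * H * (1 + H) ^+ n * mdist (f p) (f q) / 2 by field.
lra.
Qed.

(** * Logarithmic bound for k, and chains of balls along arcs of G *)

Section qh_estimate.
Variable n0 : nat.
Hypothesis hn0 : 16 * c ^+ 2 <= n0%:R.

(** The threshold of [wqs_inverse_local] for mu = 1 / (4 c), which is why n0 is at least 16 c^2. *)
Let T := 4 * c * H * (1 + H) ^+ n0.
Let T1 : 1 <= T.
Proof.
have cH : 1 <= c * H by exact: mulr_ege1.
have : 1 <= c * H * (1 + H) ^+ n0 by exact: mulr_ege1.
rewrite /T => h1; have -> : 4 * c * H * (1 + H) ^+ n0 =
  4 * (c * H * (1 + H) ^+ n0) by ring.
by lra.
Qed.
Let T0 : 0 < T. Proof. exact: lt_le_trans T1. Qed.

Lemma qh_dist_step p q : G p -> G q ->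
  T * mdist (f p) (f q) <= bdist G' (f p) \/
  T * mdist (f p) (f q) <= bdist G' (f q) -> (qh_dist G p q <= 1%:E)%E.
Proof.
move=> Gp Gq pq; apply: (qh_dist_local_le1 c1 qX dG GX Gp Gq).
have m0 : 0 < (4 * c)^-1 by rewrite invr_gt0 mulr_gt0.
have m2 : (4 * c)^-1 <= 2^-1 :> R.
  by rewrite lef_pV2 ?posrE ?mulr_gt0//; move: c1; lra.
have mn : 4 * c <= n0%:R * (4 * c)^-1.
  by rewrite ler_pdivlMr ?mulr_gt0//; apply: le_trans hn0; rewrite expr2; lra.
case: pq => pq; [left|right]; rewrite mulrC.
  exact: wqs_inverse_local m0 m2 mn Gp Gq pq.
rewrite metric_sym; apply: (wqs_inverse_local m0 m2 mn Gq Gp).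
by rewrite metric_sym.
Qed.

(** A step of tau times a length which the cone condition bounds by b delta' is short enough for
    [qh_dist_step]. *)
Let tau := (b * T)^-1.
Let tau0 : 0 < tau. Proof. by rewrite invr_gt0 mulr_gt0. Qed.
Let Ttau x : T * (tau * x) <= x / b.
Proof.
rewrite /tau le_eqVlt; apply/orP; left; apply/eqP; field.
by rewrite !gt_eqF.
Qed.

(** The arc is cut at points whose lengths from g a are in the ratio 1 + tau, and each step costs at
    most 1 in k. The first piece, of length at most tau delta'(g a), accounts for the successor. *)
Lemma qh_dist_uniform_left a d (g : R -> Y) n t : qh_arc G' a d g ->
  (forall s, s \in `[a, t] -> len g a s <= b * bdist G' (g s)) ->
  t \in `[a, d] -> len g a t <= (1 + tau) ^+ n * (tau * bdist G' (g a)) ->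
  (qh_dist G (h (g a)) (h (g t)) <= n.+1%:R%:E)%E.
Proof.
move=> qg + tad; have [[ad cg _] gG rg] := qg.
elim: n t tad => [|n IH] t tad gb gl.
  have Gt := qh_arc_in qg tad.
  have /andP[at_ td] : a <= t <= d by move: tad; rewrite in_itv.
  have Ga : G' (g a) by apply: (qh_arc_in qg); rewrite in_itv/= lexx.
  have k0 := bdist_gt0 bG' oG' Ga.
  apply: qh_dist_step; rewrite ?inverseK//; [exact: inverse_in..|left].
  apply: le_trans (_ : T * (tau * bdist G' (g a)) <= _).
    rewrite ler_pM2l//; move: gl; rewrite expr0 mul1r; apply: le_trans.
    by rewrite mdist_le_len//; exact: rectifiable_sub rg _ _ _.
  by apply: le_trans (Ttau _) _; rewrite ler_pdivrMr// ler_peMr// ltW.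
have /andP[at_ td] : a <= t <= d by move: tad; rewrite in_itv.
have rt := rectifiable_sub rg (lexx a) at_ td.
have [[_ ct _] _ _] := qh_arc_sub qg (lexx a) at_ td.
have st0 : 0 < 1 + tau by rewrite addr_gt0.
have v0 : 0 <= len g a t / (1 + tau) by rewrite divr_ge0 ?len_ge0// ltW.
have vt : len g a t / (1 + tau) <= len g a t.
  by rewrite ler_pdivrMr// ler_peMr ?len_ge0// lerDl ltW.
have [t1 t1at t1v] := len_IVT at_ ct rt v0 vt.
have /andP[at1 t1t] : a <= t1 <= t by move: t1at; rewrite in_itv.
have t1ad : t1 \in `[a, d] by rewrite in_itv/= at1 (le_trans t1t).
have Gt := qh_arc_in qg tad; have Gt1 := qh_arc_in qg t1ad.
have lt : len g a t = len g a t1 * (1 + tau) by rewrite t1v mulfVK// gt_eqF.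
have l2 : len g t1 t = tau * len g a t1.
  by have := lenD at1 t1t rt; rewrite lt mulrDr mulr1 mulrC => /addrI.
apply: le_trans (qh_dist_triangle oG bG _ (h (g t1)) _) _.
rewrite -natr1 EFinD; apply: leeD.
  apply: IH => //; last by move: gl; rewrite lt exprS -mulrA mulrC ler_pM2l.
  move=> s; rewrite in_itv/= => /andP[as_ st1]; apply: gb.
  by rewrite in_itv/= as_ (le_trans st1).
apply: qh_dist_step; rewrite ?inverseK//; [exact: inverse_in..|left].
apply: le_trans (_ : T * (tau * (b * bdist G' (g t1))) <= _).
  rewrite ler_pM2l//; apply: le_trans (_ : tau * len g a t1 <= _).
    by rewrite -l2 mdist_le_len//; exact: rectifiable_sub rt _ _ _.
  by rewrite ler_pM2l// gb.
by apply: le_trans (Ttau _) _; rewrite mulrC mulKf// gt_eqF.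
Qed.

Lemma qh_dist_uniform_right a d (g : R -> Y) n t : qh_arc G' a d g ->
  (forall s, s \in `[t, d] -> len g s d <= b * bdist G' (g s)) ->
  t \in `[a, d] -> len g t d <= (1 + tau) ^+ n * (tau * bdist G' (g d)) ->
  (qh_dist G (h (g t)) (h (g d)) <= n.+1%:R%:E)%E.
Proof.
move=> qg + tad; have [[ad cg _] gG rg] := qg.
elim: n t tad => [|n IH] t tad gb gl.
  have Gt := qh_arc_in qg tad.
  have /andP[at_ td] : a <= t <= d by move: tad; rewrite in_itv.
  have Gd : G' (g d) by apply: (qh_arc_in qg); rewrite in_itv/= lexx andbT.
  have k0 := bdist_gt0 bG' oG' Gd.
  apply: qh_dist_step; rewrite ?inverseK//; [exact: inverse_in..|right].
  apply: le_trans (_ : T * (tau * bdist G' (g d)) <= _).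
    rewrite ler_pM2l//; move: gl; rewrite expr0 mul1r; apply: le_trans.
    by rewrite mdist_le_len//; exact: rectifiable_sub rg _ _ _.
  by apply: le_trans (Ttau _) _; rewrite ler_pdivrMr// ler_peMr// ltW.
have /andP[at_ td] : a <= t <= d by move: tad; rewrite in_itv.
have rt := rectifiable_sub rg at_ td (lexx d).
have [[_ ct _] _ _] := qh_arc_sub qg at_ td (lexx d).
have st0 : 0 < 1 + tau by rewrite addr_gt0.
have v0 : 0 <= len g t d - len g t d / (1 + tau).
  by rewrite subr_ge0 ler_pdivrMr// ler_peMr ?len_ge0// lerDl ltW.
have vt : len g t d - len g t d / (1 + tau) <= len g t d.
  by rewrite lerBlDr lerDl divr_ge0 ?len_ge0// ltW.
have [t1 t1at t1v] := len_IVT td ct rt v0 vt.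
have /andP[tt1 t1d] : t <= t1 <= d by move: t1at; rewrite in_itv.
have t1ad : t1 \in `[a, d] by rewrite in_itv/= t1d (le_trans at_).
have Gt := qh_arc_in qg tad; have Gt1 := qh_arc_in qg t1ad.
have ltd := lenD tt1 t1d rt.
have l1 : len g t1 d = len g t d / (1 + tau) by move: ltd; rewrite t1v; lra.
have lt : len g t d = len g t1 d * (1 + tau) by rewrite l1 mulfVK// gt_eqF.
have l2 : len g t t1 = tau * len g t1 d.
  by move: ltd; rewrite lt mulrDr mulr1 addrC mulrC => /addIr.
apply: le_trans (qh_dist_triangle oG bG _ (h (g t1)) _) _.
rewrite -natr1 EFinD [leLHS]addeC; apply: leeD.
  apply: IH => //; last by move: gl; rewrite lt exprS -mulrA mulrC ler_pM2l.
  move=> s; rewrite in_itv/= => /andP[t1s sd]; apply: gb.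
  by rewrite in_itv/= sd (le_trans tt1).
apply: qh_dist_step; rewrite ?inverseK//; [exact: inverse_in..|right].
apply: le_trans (_ : T * (tau * (b * bdist G' (g t1))) <= _).
  rewrite ler_pM2l//; apply: le_trans (_ : tau * len g t1 d <= _).
    by rewrite -l2 mdist_le_len//; exact: rectifiable_sub rg _ _ _.
  by rewrite ler_pM2l// gb.
by apply: le_trans (Ttau _) _; rewrite mulrC mulKf// gt_eqF.
Qed.

(** n stands for the logarithm of |f u - f v| / s to the base 1 + tau. A uniform arc is halved by
    length, so that on each half the minimum in the cone condition is the length to the end of that
    half. *)
Lemma qh_dist_uniform n u v s : G u -> G v ->
  s <= bdist G' (f u) -> s <= bdist G' (f v) ->
  b * mdist (f u) (f v) <= (1 + tau) ^+ n * (tau * s) ->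
  (qh_dist G u v <= (2 * n.+1)%:R%:E)%E.
Proof.
move=> Gu Gv su sv uv.
have [a [d [g [qg ga gd gl gb]]]] := uniform_arc (fG Gu) (fG Gv).
have [[ad cg _] gG rg] := qg; have L0 := len_ge0 g ad.
have st0 : 0 < (1 + tau) ^+ n by rewrite exprn_gt0// addr_gt0.
have v0 : 0 <= len g a d / 2 by rewrite divr_ge0.
have vL : len g a d / 2 <= len g a d by lra.
have [m mad mv] := len_IVT ad cg rg v0 vL.
have /andP[am md] : a <= m <= d by move: mad; rewrite in_itv.
have mD := lenD am md rg.
have sn x : s <= x -> (1 + tau) ^+ n * (tau * s) <= (1 + tau) ^+ n * (tau * x).
  by move=> sx; rewrite ler_pM2l// ler_pM2l.
rewrite -(fK Gu) -(fK Gv) -ga -gd.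
apply: le_trans (qh_dist_triangle oG bG _ (h (g m)) _) _.
rewrite mul2n -addnn natrD EFinD; apply: leeD.
  apply: (qh_dist_uniform_left qg) => //.
    move=> t; rewrite in_itv/= => /andP[at_ tm].
    have tad : t \in `[a, d] by rewrite in_itv/= at_ (le_trans tm).
    have := gb t tad; rewrite ge_min => /orP[//|]; apply: le_trans.
    have := lenD at_ (le_trans tm md) rg; have := len_homo rg at_ tm md; lra.
  apply: le_trans (_ : b * mdist (f u) (f v) <= _); first by lra.
  by rewrite ga; apply: le_trans uv (sn _ su).
apply: (qh_dist_uniform_right qg) => //.
  move=> t; rewrite in_itv/= => /andP[mt td].
  have tad : t \in `[a, d] by rewrite in_itv/= td (le_trans am).
  have := gb t tad; rewrite ge_min => /orP[|//]; apply: le_trans.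
  have := lenD (le_trans am mt) td rg; have := len_homo rg am mt td; lra.
apply: le_trans (_ : b * mdist (f u) (f v) <= _); first by lra.
by rewrite gd; apply: le_trans uv (sn _ sv).
Qed.

Let K := 3 * H.
Let Kge1 : 1 <= K. Proof. by rewrite /K; move: H1; lra. Qed.
Let Kgt0 : 0 < K. Proof. exact: lt_le_trans Kge1. Qed.
Let KX0 n : 0 < (1 + K) ^+ n. Proof. by rewrite exprn_gt0// addr_gt0. Qed.

Lemma bdist_image_close u v : G u -> G v -> mdist u v <= bdist G u / (4 * c) ->
  bdist G' (f v) <= (1 + K) * bdist G' (f u).
Proof.
move=> Gu Gv uv; have := wqs_bdist Gu Gv uv.
have := bdist_lipschitz bG' (f v) (f u); rewrite metric_sym -/K; lra.
Qed.

(** Leaving a ball of radius delta / (4 c) takes quasihyperbolic length at least 1 / (5 c), so n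
    balls suffice. In general delta' may grow by 1 + K in each ball; under an a priori bound S every
    ball costs at most K S, and the size is linear in n. *)
Lemma image_chain a d (g : R -> X) n : qh_arc G a d g ->
  (qh_length G a d g < (n%:R / (5 * c))%:E)%E -> forall t, t \in `[a, d] ->
  bdist G' (f (g t)) <= (1 + K) ^+ n * bdist G' (f (g a)) /\
  (forall S, (forall s, s \in `[a, d] -> bdist G' (f (g s)) <= S) ->
     mdist (f (g a)) (f (g t)) <= n%:R * (K * S)).
Proof.
elim: n a => [|n IH] a qg.
  by rewrite mul0r ltNge qh_length_ge0.
move=> lg t tad; have [[ad cg _] _ rg] := qg.
have /andP[at_ td] : a <= t <= d by move: tad; rewrite in_itv.
have aad : a \in `[a, d] by rewrite in_itv/= lexx.
have Ga := qh_arc_in qg aad; have Gt := qh_arc_in qg tad.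
have a0 := bdist_gt0 bG oG Ga; have k0 := bdist_gt0 bG' oG' (fG Ga).
set D := bdist G (g a) in a0.
have r0 : 0 < D / (4 * c) by rewrite divr_gt0// mulr_gt0.
have KS S : (forall s, s \in `[a, d] -> bdist G' (f (g s)) <= S) ->
    bdist G' (f (g a)) <= S by exact.
have nK S : 0 <= S -> 0 <= n%:R * (K * S) by move=> S0; rewrite !mulr_ge0// ltW.
have [le|lt] := leP (mdist (g a) (g t)) (D / (4 * c)).
  split.
    apply: le_trans (bdist_image_close Ga Gt le) _; rewrite exprS -mulrA.
    rewrite ler_pM2l ?addr_gt0// ler_peMl ?(ltW k0)// exprn_ege1//.
    by rewrite lerDl ltW.
  move=> S dS; have aS := KS S dS.
  have S0 : 0 <= S by rewrite (le_trans _ aS) ?ltW.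
  have := wqs_bdist Ga Gt le; rewrite -/K => h1.
  have h2 : K * bdist G' (f (g a)) <= K * S by rewrite ler_pM2l.
  have := nK S S0; rewrite -natr1 mulrDl mul1r; lra.
have [t0 [t0ad t0t dt0 t0P]] := exit_ball cg (ltW r0) tad (ltW lt).
have /andP[at0 t0d] : a <= t0 <= d by move: t0ad; rewrite in_itv.
have Gt0 := qh_arc_in qg t0ad.
have q1 := qh_arc_sub qg (lexx a) at0 t0d.
have q2 := qh_arc_sub qg at0 t0d (lexx d).
have c5 : 0 < 5 * c by rewrite mulr_gt0.
have l1 : ((5 * c)^-1%:E <= qh_length G a t0 g)%E.
  (* Inside the ball, delta is at most D + D / (4 c) <= 5 D / 4. *)
  have M0 : 0 < 5 / 4 * D by rewrite !mulr_gt0.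
  apply: le_trans (qh_length_ge oG bG q1 M0 _).
    rewrite lee_fin ler_pdivlMr//.
    have -> : (5 * c)^-1 * (5 / 4 * D) = D / (4 * c) by field; rewrite gt_eqF.
    by rewrite -dt0 mdist_le_len//; case: q1.
  move=> s; rewrite in_itv/= => /andP[as_ st0].
  have sad : s \in `[a, d] by rewrite in_itv/= as_ (le_trans st0).
  have := bdist_lipschitz bG (g s) (g a); have := t0P s sad st0.
  rewrite -/D metric_sym.
  have : D / (4 * c) <= D / 4.
    by rewrite ler_pM2l// lef_pV2 ?posrE ?mulr_gt0// ler_peMr.
  lra.
have l2 : (qh_length G t0 d g < (n%:R / (5 * c))%:E)%E.
  move: lg; rewrite (qh_lengthD oG bG qg at0 t0d) -natr1 mulrDl mul1r.
  move: l1 (qh_length_ge0 bG t0 d g).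
  case: (qh_length G a t0 g) => [u||] //; case: (qh_length G t0 d g) => [v||] //.
  by rewrite !lee_fin -EFinD !lte_fin; lra.
have tt0 : t \in `[t0, d] by rewrite in_itv/= t0t.
have [IH1 IH2] := IH t0 q2 l2 t tt0.
have close : mdist (g a) (g t0) <= D / (4 * c) by rewrite dt0.
have B := bdist_image_close Ga Gt0 close.
split.
  by apply: le_trans IH1 _; rewrite exprSr -mulrA ler_pM2l.
move=> S dS; have aS := KS S dS.
have := wqs_bdist Ga Gt0 close; rewrite -/K => h1.
have h2 : K * bdist G' (f (g a)) <= K * S by rewrite ler_pM2l.
have h3 : mdist (f (g t0)) (f (g t)) <= n%:R * (K * S).
  apply: IH2 => s; rewrite in_itv/= => /andP[t0s sd]; apply: dS.
  by rewrite in_itv/= sd (le_trans at0).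
have := metric_triangle (f (g a)) (f (g t0)) (f (g t)).
rewrite -natr1 mulrDl mul1r; lra.
Qed.

(** Finiteness is read off the logarithmic bound; it permits the cancellation of lengths in
    [short_subarc]. *)
Lemma qh_dist_fin u v : G u -> G v -> (qh_dist G u v < +oo)%E.
Proof.
move=> Gu Gv; have u0 := bdist_gt0 bG' oG' (fG Gu).
have v0 := bdist_gt0 bG' oG' (fG Gv).
pose s := Num.min (bdist G' (f u)) (bdist G' (f v)).
have s0 : 0 < s by rewrite lt_min u0.
have Q0 : 0 <= b * mdist (f u) (f v) / s.
  by rewrite divr_ge0 ?(ltW s0)// mulr_ge0 ?mdist_ge0// ltW.
have [N /(_ N (leqnn N))] := linear_le_geometric tau0 (lexx 0) Q0.
rewrite mul0r add0r ler_pdivrMr// -mulrA => uv.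
by apply: le_lt_trans (qh_dist_uniform Gu Gv _ _ uv) (ltry _);
  rewrite ge_min lexx ?orbT.
Qed.

(** By the triangle inequality, what a subarc exceeds the distance of its endpoints by is no more
    than what the whole arc does. *)
Lemma short_subarc eps a d (g : R -> X) x y s t : short_arc G eps a d g x y ->
  a <= s -> s <= t -> t <= d ->
  (qh_length G s t g <= qh_dist G (g s) (g t) + eps%:E)%E.
Proof.
move=> [[ag ga gd] gG rg lg] as_ st td.
have qg : qh_arc G a d g by split.
have sd := le_trans st td; have at_ := le_trans as_ st.
have q1 := qh_arc_sub qg (lexx a) as_ sd.
have q2 := qh_arc_sub qg as_ st td.
have q3 := qh_arc_sub qg at_ td (lexx d).
have ad := le_trans as_ sd.
have Gx : G x by rewrite -ga; apply: (qh_arc_in qg); rewrite in_itv/= lexx.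
have Gy : G y by rewrite -gd; apply: (qh_arc_in qg); rewrite in_itv/= lexx andbT.
have k1 := qh_dist_le q1; have k3 := qh_dist_le q3.
have tri : (qh_dist G x y <= qh_length G a s g +
    (qh_dist G (g s) (g t) + qh_length G t d g))%E.
  rewrite -ga -gd; apply: le_trans (qh_dist_triangle oG bG _ (g s) _) _.
  apply: (leeD k1); apply: le_trans (qh_dist_triangle oG bG _ (g t) _) _.
  exact: (leeD (lexx _) k3).
move: lg tri (qh_dist_fin Gx Gy) (qh_dist_ge0 bG x y).
rewrite (qh_lengthD oG bG qg as_ sd).
rewrite (qh_lengthD oG bG (qh_arc_sub qg as_ sd (lexx d)) st td).
move: (qh_length_ge0 bG a s g) (qh_length_ge0 bG s t g) (qh_length_ge0 bG t d g).
move: (qh_dist_ge0 bG (g s) (g t)).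
case: (qh_dist G (g s) (g t)) => [k||] //; last by move=> *; rewrite leey.
case: (qh_length G a s g) => [l1||] //; case: (qh_length G s t g) => [l2||] //;
  case: (qh_length G t d g) => [l3||] //; case: (qh_dist G x y) => [k'||] //.
by rewrite -!EFinD !lee_fin; lra.
Qed.

(** * Images of short arcs *)

Section short_arcs.
Variable M : nat.
Hypothesis hM : 5 * c <= M%:R.

(** Number of balls along a short arc whose endpoints are at distance at most 2 (N + 1): eps < 1
    adds 1, each unit takes M >= 5 c balls, and the successor makes the inequality of [image_chain]
    strict. *)
Let chain_steps N := (M * (2 * N + 3)).+1.

Lemma chain_stepsP N :
  (2 * N.+1)%:R + 1 < (chain_steps N)%:R / (5 * c) :> R.
Proof.
have -> : (2 * N.+1)%:R + 1 = (2 * N + 3)%:R :> R.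
  by rewrite natr1 mulnSr addn2 addn3.
have -> : (chain_steps N)%:R = M%:R * (2 * N + 3)%:R + 1 :> R.
  by rewrite -natrM natr1.
rewrite ltr_pdivlMr ?mulr_gt0//.
apply: (@le_lt_trans _ _ (M%:R * (2 * N + 3)%:R)); last by rewrite ltrDl.
by rewrite mulrC ler_wpM2r.
Qed.

Variables (eps a d : R) (g : R -> X) (x y : X).
Hypothesis sg : short_arc G eps a d g x y.
Hypothesis eps1 : eps < 1.

Let phi := f \o g.
Let dt t := bdist G' (phi t).
Let qg : qh_arc G a d g. Proof. by case: sg => -[ag _ _] gG rg _; split. Qed.
Let ad : a <= d. Proof. by case: qg => -[]. Qed.
Let itvP v w u : a <= v -> w <= d -> u \in `[v, w] -> u \in `[a, d].
Proof.
by rewrite !in_itv/= => av wd /andP[/(le_trans av)-> /le_trans->].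
Qed.
Let dt0 t : t \in `[a, d] -> 0 < dt t.
Proof. by move=> tad; apply: bdist_gt0 => //; apply/fG/(qh_arc_in qg). Qed.

(** [image_chain] controls delta' only forward from the start of a subarc. Applied from v it bounds
    delta' at t from above; applied from t to w it bounds it from below. *)
Lemma short_chain v w N s : a <= v -> v <= w -> w <= d ->
  s <= dt v -> s <= dt w ->
  b * mdist (phi v) (phi w) <= (1 + tau) ^+ N * (tau * s) ->
  forall t, t \in `[v, w] ->
  [/\ dt t <= (1 + K) ^+ chain_steps N * dt v,
      dt w <= (1 + K) ^+ chain_steps N * dt t &
      forall S, (forall u, u \in `[v, w] -> dt u <= S) ->
        mdist (phi v) (phi t) <= (chain_steps N)%:R * (K * S)].
Proof.
move=> av vw wd sv sw vwN t tvw.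
have vad : v \in `[a, d] by rewrite in_itv/= av (le_trans vw).
have wad : w \in `[a, d] by rewrite in_itv/= wd (le_trans av).
have Gv := qh_arc_in qg vad; have Gw := qh_arc_in qg wad.
have k := qh_dist_uniform Gv Gw sv sw vwN.
have /andP[vt tw] : v <= t <= w by move: tvw; rewrite in_itv.
have qvw := qh_arc_sub qg av vw wd.
have qtw := qh_arc_sub qg (le_trans av vt) tw wd.
have lvw : (qh_length G v w g < ((chain_steps N)%:R / (5 * c))%:E)%E.
  apply: le_lt_trans (short_subarc sg av vw wd) _.
  apply: le_lt_trans (leeD k (_ : eps%:E <= 1%:E)%E) _.
    by rewrite lee_fin ltW.
  by rewrite -EFinD lte_fin chain_stepsP.
have ltw : (qh_length G t w g < ((chain_steps N)%:R / (5 * c))%:E)%E.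
  apply: le_lt_trans lvw; rewrite (qh_lengthD oG bG qvw vt tw).
  by rewrite leeDr// qh_length_ge0.
have wtw : w \in `[t, w] by rewrite in_itv/= lexx andbT.
have [h1 h2] := image_chain qvw lvw tvw.
by have [h3 _] := image_chain qtw ltw wtw.
Qed.

(** Let n be the least exponent with b |phi v - phi w| <= (1 + tau)^n tau s. Chaining bounds |phi v
    - phi w| by a multiple of s linear in n. If n exceeded N0, that bound would already fit under
    the exponent n - 1, against minimality; so N0 itself is a valid exponent. *)
Lemma short_tame A N0 : 0 <= A ->
  (forall n, (N0 <= n)%N ->
    b * ((chain_steps n.+1)%:R * (K * A)) <= (1 + tau) ^+ n * tau) ->
  tame phi dt a d A
    (2 * ((chain_steps N0)%:R * (K * A)) + (1 + K) ^+ chain_steps N0).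
Proof.
move=> A0 hN0 v w s av vw wd s0 sv sw dA.
have exN : exists n, b * mdist (phi v) (phi w) <= (1 + tau) ^+ n * (tau * s).
  have Q0 : 0 <= b * mdist (phi v) (phi w) / s.
    by rewrite divr_ge0 ?(ltW s0)// mulr_ge0 ?mdist_ge0// ltW.
  have [N /(_ N (leqnn N))] := linear_le_geometric tau0 (lexx 0) Q0.
  by rewrite mul0r add0r ler_pdivrMr// -mulrA => uv; exists N.
have [n nP nmin] := ex_minnP exN.
have wvw : w \in `[v, w] by rewrite in_itv/= vw lexx.
have vvw : v \in `[v, w] by rewrite in_itv/= vw lexx.
have nN0 : (n <= N0)%N.
  rewrite leqNgt; apply/negP => N0n.
  have [m nm] : exists m, n = m.+1.
    by exists n.-1; rewrite prednK// (leq_ltn_trans _ N0n).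
  have [_ _ /(_ _ dA) far] := short_chain av vw wd sv sw nP wvw.
  suff : (n <= m)%N by rewrite nm ltnn.
  apply: nmin; apply: le_trans (_ : b * ((chain_steps n)%:R * (K * (A * s))) <= _).
    by rewrite ler_pM2l.
  rewrite nm; have := hN0 m; rewrite -ltnS -nm => /(_ N0n) h'.
  have -> : b * ((chain_steps n)%:R * (K * (A * s))) =
    b * ((chain_steps n)%:R * (K * A)) * s by ring.
  by rewrite [leRHS]mulrA ler_pM2r.
have nP' : b * mdist (phi v) (phi w) <= (1 + tau) ^+ N0 * (tau * s).
  apply: le_trans nP _; apply: ler_wpM2r; first by rewrite mulr_ge0// ltW.
  by rewrite ler_weXn2l// lerDl ltW.
move=> u u' uvw u'vw.
have [h1 h2 /(_ _ dA) h3] := short_chain av vw wd sv sw nP' uvw.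
have [_ _ /(_ _ dA) h3'] := short_chain av vw wd sv sw nP' u'vw.
have du := dt0 (itvP av wd uvw).
have m0 : 0 <= (chain_steps N0)%:R * (K * A) by rewrite !mulr_ge0// ltW.
split.
  have := metric_triangle (phi u) (phi v) (phi u').
  rewrite (metric_sym (phi u) (phi v)).
  have := mulr_ge0 (ltW (KX0 (chain_steps N0))) (ltW s0).
  lra.
apply: le_trans sw _; apply: le_trans h2 _; rewrite ler_pM2r// lerDr.
by rewrite mulr_ge0.
Qed.

Let dt_continuous : {within `[a, d], continuous dt}.
Proof.
have [[_ /itv_continuousP cg _] _ _] := qg.
apply/within_continuous_realP => t /= tad e e0.
have Gt := qh_arc_in qg tad.
have /within_continuous_mdistP/(_ _ Gt _ e0)[r r0 rP] := cf.
have [r' r'0 r'P] := cg _ tad _ r0; exists r' => // s sad ts.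
have : mdist (phi t) (phi s) < e.
  by apply: rP; [exact: (qh_arc_in qg) | rewrite ballEmdist/=; exact: r'P].
have := bdist_lipschitz bG' (phi t) (phi s).
have := bdist_lipschitz bG' (phi s) (phi t); rewrite (metric_sym (phi s)) -!/(dt _).
move=> h1 h2 h3; rewrite ltr_norml; apply/andP; split; lra.
Qed.

Section cone_arc.
Variables (C C' : R).
Hypotheses (C1 : 1 <= C) (C'0 : 0 <= C').
Hypotheses (tC : tame phi dt a d 1 C) (tC' : tame phi dt a d (2 * C) C').

Lemma short_cone : exists z, [/\ z \in `[a, d],
  (forall t, t \in `[a, d] -> dt t <= dt z),
  (forall u t t', u \in `[a, z] -> t \in `[a, u] -> t' \in `[a, u] ->
    mdist (phi t) (phi t') <= 4 * C * C' * dt u) &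
  (forall u t t', u \in `[z, d] -> t \in `[u, d] -> t' \in `[u, d] ->
    mdist (phi t) (phi t') <= 4 * C * C' * dt u)].
Proof.
have [z zad zP] := EVT_max ad dt_continuous.
exists z; split => //.
  exact: (tame_left C1 C'0 dt_continuous dt0 tC tC' zad zP).
exact: (tame_right C1 C'0 dt_continuous dt0 tC tC' zad zP).
Qed.

(** Outside the first and last times v, w at which delta' equals S, the cone estimate gives size at
    most L S. So phi v and phi w are at most (2 L + 1) S apart, and a chain of bounded length covers
    what lies between. If delta' never exceeds S, the cone estimate at its maximum is enough. *)
Lemma short_turning_far S N : 0 < S -> dt a <= S -> dt d <= S ->
  mdist (phi a) (phi d) <= S ->
  b * (8 * C * C' + 1) <= (1 + tau) ^+ N * tau ->
  forall t t', t \in `[a, d] -> t' \in `[a, d] ->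
  mdist (phi t) (phi t') <= 2 * (12 * C * C' + 1 +
    (chain_steps N)%:R * (K * (1 + K) ^+ chain_steps N)) * S.
Proof.
move=> S0 aS dS adS hN.
set Q := (chain_steps N)%:R * (K * (1 + K) ^+ chain_steps N).
have Q0 : 0 <= Q by rewrite !mulr_ge0 ?ltW.
have QS : 0 <= Q * S by rewrite mulr_ge0// ltW.
have [z [zad zP zl zr]] := short_cone.
have /andP[az zd] : a <= z <= d by move: zad; rewrite in_itv.
set L := 4 * C * C' in zl zr.
have CC' : 0 <= C * C' by rewrite mulr_ge0// (le_trans _ C1).
have L0 : 0 <= L by rewrite /L -mulrA mulr_ge0.
have LS : 0 <= L * S by rewrite mulr_ge0// ltW.
have bound : 2 * (12 * C * C' + 1 + Q) * S = 2 * (3 * (L * S) + S + Q * S).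
  by rewrite /L; ring.
suff [p pP] : exists p, forall t, t \in `[a, d] ->
    mdist p (phi t) <= 3 * (L * S) + S + Q * S.
  move=> t t' tad t'ad; rewrite bound.
  have := metric_triangle (phi t) p (phi t'); rewrite (metric_sym (phi t) p).
  have := pP t tad; have := pP t' t'ad; lra.
have [zS|Sz] := leP (dt z) S.
  exists (phi z) => t tad.
  have LzS : L * dt z <= L * S by rewrite ler_wpM2l.
  have [tz|zt] := leP t z.
    have := zl z z t; rewrite !in_itv/= az lexx tz.
    have -> : a <= t by move: tad; rewrite in_itv/= => /andP[].
    by move=> /(_ isT isT isT); lra.
  have := zr z z t; rewrite !in_itv/= zd lexx (ltW zt).
  have -> : t <= d by move: tad; rewrite in_itv/= => /andP[].
  by move=> /(_ isT isT isT); lra.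
have csub v w : a <= v -> w <= d -> {within `[v, w], continuous dt}.
  by move=> av wd; apply: continuous_subspaceW dt_continuous => u /=; exact: itvP.
have zaz : z \in `[a, z] by rewrite in_itv/= az lexx.
have zzd : z \in `[z, d] by rewrite in_itv/= zd lexx.
have [v [+ _ dv _]] := first_reach (csub _ _ (lexx a) zd) zaz aS (ltW Sz).
have [w [+ _ dw _]] := last_reach (csub _ _ az (lexx d)) zzd dS (ltW Sz).
rewrite !in_itv/= => /andP[zw wd] /andP[av vz].
have vw := le_trans vz zw.
have left t : a <= t -> t <= v -> mdist (phi v) (phi t) <= L * S.
  by move=> at_ tv; rewrite -dv; apply: zl; rewrite in_itv/= ?av ?lexx ?at_.
have right t : w <= t -> t <= d -> mdist (phi w) (phi t) <= L * S.
  by move=> wt td; rewrite -dw; apply: zr; rewrite in_itv/= ?zw ?wd ?lexx ?wt.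
have mvw : mdist (phi v) (phi w) <= 2 * (L * S) + S.
  have := metric_triangle (phi v) (phi a) (phi w).
  have := metric_triangle (phi a) (phi d) (phi w).
  have := left a (lexx a) av; have := right d wd (lexx d).
  by rewrite (metric_sym (phi w)); lra.
exists (phi v) => t; rewrite in_itv/= => /andP[at_ td].
have [tv|vt] := leP t v; first by have := left t at_ tv; lra.
have [wt|tw] := leP w t.
  have := metric_triangle (phi v) (phi w) (phi t); have := right t wt td; lra.
have tvw : t \in `[v, w] by rewrite in_itv/= !ltW.
have hN' : b * mdist (phi v) (phi w) <= (1 + tau) ^+ N * (tau * S).
  apply: (@le_trans _ _ (b * (8 * C * C' + 1) * S)).
    rewrite -mulrA ler_pM2l//; apply: le_trans mvw _.
    by rewrite /L le_eqVlt; apply/orP; left; apply/eqP; ring.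
  by rewrite mulrA ler_pM2r.
have [||_ _ far] := short_chain av vw wd _ _ hN' tvw; rewrite ?dv ?dw//.
have : mdist (phi v) (phi t) <=
    (chain_steps N)%:R * (K * ((1 + K) ^+ chain_steps N * S)).
  apply: far => u uvw.
  have [||+ _ _] := short_chain av vw wd _ _ hN' uvw; rewrite ?dv ?dw//.
have -> : (chain_steps N)%:R * (K * ((1 + K) ^+ chain_steps N * S)) = Q * S.
  by rewrite /Q; ring.
lra.
Qed.

End cone_arc.

(** Here |g a - g d| = r is at most D / (28 c^2), where 112 c^3 = 4 c times 28 c^2. Once the arc is
    known to stay within 4 c r of g a, each of its points is joined to g a by an arc of length at
    most 4 c^2 r, that is 8 c^2 steps of r / 2, and [wqs_chain] applies. *)
Lemma short_turning_near n1 n2 : 112 * c ^+ 3 <= n1%:R -> 8 * c ^+ 2 <= n2%:R ->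
  (eps%:E < qh_dist G x y * (6^-1)%:E)%E -> 0 < eps ->
  4 * c * H * (1 + H) ^+ n1 * mdist (phi a) (phi d) <= dt a ->
  forall t, t \in `[a, d] ->
  mdist (phi a) (phi t) <= (1 + H) ^+ n2 * mdist (phi a) (phi d).
Proof.
move=> hn1 hn2 epsk eps0 near t tad.
have aad : a \in `[a, d] by rewrite in_itv/= lexx.
have dad : d \in `[a, d] by rewrite in_itv/= lexx andbT.
have Ga := qh_arc_in qg aad; have Gd := qh_arc_in qg dad.
have Gt := qh_arc_in qg tad.
have [gax gdy] : g a = x /\ g d = y by case: sg => -[].
have D0 := bdist_gt0 bG oG Ga; set D := bdist G (g a) in D0.
set r := mdist (g a) (g d).
have c20 : 0 < c ^+ 2 by rewrite exprn_gt0.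
have c21 : c <= c ^+ 2 by rewrite expr2 ler_peMr// ltW.
pose mu := (28 * c ^+ 2)^-1.
have mu0 : 0 < mu by rewrite invr_gt0 mulr_gt0.
have c2ge1 : 1 <= c ^+ 2 by exact: le_trans c1 c21.
have mu2 : mu <= 2^-1 by rewrite lef_pV2 ?posrE ?mulr_gt0//; lra.
have mun : 4 * c <= n1%:R * mu.
  rewrite ler_pdivlMr ?mulr_gt0//; apply: le_trans hn1.
  by rewrite le_eqVlt; apply/orP; left; apply/eqP; ring.
have rmu : r <= mu * D by exact: wqs_inverse_local mu0 mu2 mun Ga Gd near.
have r28 : 28 * c ^+ 2 * r <= D.
  by move: rmu; rewrite /mu mulrC ler_pdivlMr ?mulr_gt0// mulrC.
have rge0 : 0 <= r by exact: mdist_ge0.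
have cr : c * r <= c ^+ 2 * r by rewrite ler_wpM2r.
have k : (qh_dist G x y <= (2 * c * r / D)%:E)%E.
  rewrite -gax -gdy; apply: (qh_dist_local c1 qX dG GX Ga).
  by rewrite -/r -/D; move: r28 cr; lra.
have [kk kE] : exists kk, qh_dist G x y = kk%:E.
  by exists (fine (qh_dist G x y)); rewrite fineK// ge0_fin_numE ?qh_dist_ge0//
    (le_lt_trans k) ?ltry.
move: k epsk; rewrite kE -EFinM lee_fin lte_fin => k epsk.
have r0 : 0 < r.
  rewrite lt_neqAle rge0 andbT; apply/eqP => e; move: k; rewrite -e mulr0 mul0r.
  by move: epsk eps0; lra.
(* The bound eps < k / 6 makes the length at most 7/6 of k, and k is at most 2 c r / D. *)
have lg : (qh_length G a d g <= (7 / 3 * c * r / D)%:E)%E.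
  case: (sg) => _ _ _ /le_trans; apply; rewrite kE -EFinD lee_fin.
  have -> : 7 / 3 * c * r / D = 7 / 6 * (2 * c * r / D) by field; rewrite gt_eqF.
  lra.
have [[_ cg _] _ rg] := qg.
have inball : mdist (g a) (g t) <= 4 * c * r.
  rewrite leNgt; apply/negP => lt.
  have R0 : 0 <= 4 * c * r by rewrite !mulr_ge0 ?ltW.
  have [t0 [t0ad t0t dt0' t0P]] := exit_ball cg R0 tad (ltW lt).
  have /andP[at0 t0d] : a <= t0 <= d by move: t0ad; rewrite in_itv.
  have q1 := qh_arc_sub qg (lexx a) at0 t0d.
  (* In the ball of radius 4 c r <= D / 7, delta is at most 8 D / 7, so leaving it takes length at
     least 7/2 c r / D, more than the available 7/3 c r / D. *)
  have M0 : 0 < 8 / 7 * D by rewrite mulr_gt0.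
  have : ((4 * c * r / (8 / 7 * D))%:E <= (7 / 3 * c * r / D)%:E)%E.
    apply: le_trans lg; rewrite (qh_lengthD oG bG qg at0 t0d).
    apply: le_trans (_ : _ <= qh_length G a t0 g)%E _; last first.
      by rewrite leeDl// qh_length_ge0.
    apply: le_trans (qh_length_ge oG bG q1 M0 _).
      rewrite lee_fin ler_pM2r ?invr_gt0// -dt0' mdist_le_len//; by case: q1.
    move=> s; rewrite in_itv/= => /andP[as_ st0].
    have sad : s \in `[a, d] by rewrite in_itv/= as_ (le_trans st0).
    have := bdist_lipschitz bG (g s) (g a); have := t0P s sad st0.
    by rewrite -/D metric_sym; move: r28 cr; lra.
  have -> : 4 * c * r / (8 / 7 * D) = 7 / 2 * (c * r / D) by field; rewrite gt_eqF.
  have -> : 7 / 3 * c * r / D = 7 / 3 * (c * r / D) by field; rewrite gt_eqF.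
  have : 0 < c * r / D by rewrite divr_gt0// mulr_gt0.
  rewrite lee_fin; lra.
have ct : c * mdist (g a) (g t) <= 4 * c ^+ 2 * r.
  apply: le_trans (_ : c * (4 * c * r) <= _); first by rewrite ler_pM2l.
  by rewrite le_eqVlt; apply/orP; left; apply/eqP; ring.
have ctD : c * mdist (g a) (g t) < bdist G (g a).
  by rewrite -/D; move: ct r28 D0; lra.
have [a' [d' [g' [qg' ga' gd' gl']]]] := local_arc qX dG GX Ga ctD.
have d'ad : d' \in `[a', d'].
  by case: qg' => -[ad' _ _] _ _; rewrite in_itv/= ad' lexx.
have := wqs_chain Ga Gd qg' ga' d'ad (n := n2); rewrite gd'; apply.
apply: le_trans gl' _; apply: le_trans ct _; rewrite -/r.
have -> : 4 * c ^+ 2 * r = 8 * c ^+ 2 * (r / 2) by field.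
by rewrite ler_pM2r// divr_gt0.
Qed.

Let steps_const N := (chain_steps N)%:R * (K * (1 + K) ^+ chain_steps N).
Let tame_const A N :=
  2 * ((chain_steps N)%:R * (K * A)) + (1 + K) ^+ chain_steps N.

Lemma short_image N1 N2 N3 n1 n2 :
  let C := tame_const 1 N1 in let C' := tame_const (2 * C) N2 in
  let T' := 4 * c * H * (1 + H) ^+ n1 in
  (forall n, (N1 <= n)%N ->
    b * ((chain_steps n.+1)%:R * (K * 1)) <= (1 + tau) ^+ n * tau) ->
  (forall n, (N2 <= n)%N ->
    b * ((chain_steps n.+1)%:R * (K * (2 * C))) <= (1 + tau) ^+ n * tau) ->
  b * (8 * C * C' + 1) <= (1 + tau) ^+ N3 * tau ->
  112 * c ^+ 3 <= n1%:R -> 8 * c ^+ 2 <= n2%:R ->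
  (eps%:E < qh_dist G x y * (6^-1)%:E)%E -> 0 < eps ->
  (forall t, t \in `[a, d] ->
    (forall u u', u \in `[a, t] -> u' \in `[a, t] ->
      mdist (phi u) (phi u') <= 4 * C * C' * dt t) \/
    (forall u u', u \in `[t, d] -> u' \in `[t, d] ->
      mdist (phi u) (phi u') <= 4 * C * C' * dt t)) /\
  (forall u u', u \in `[a, d] -> u' \in `[a, d] ->
    mdist (phi u) (phi u') <= (2 * (1 + H) ^+ n2 +
      2 * (12 * C * C' + 1 + steps_const N3) * (T' + 1)) *
      mdist (phi a) (phi d)).
Proof.
move=> C C' T' hN1 hN2 hN3 hn1 hn2 epsk eps0.
have tame_ge1 A N : 0 <= A -> 1 <= tame_const A N.
  move=> A0.
  have h1 : 0 <= (chain_steps N)%:R * (K * A) by rewrite !mulr_ge0// ltW.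
  have h2 : 1 <= (1 + K) ^+ chain_steps N by rewrite exprn_ege1// lerDl ltW.
  by rewrite /tame_const; lra.
have C1 : 1 <= C by exact: tame_ge1.
have C0 : 0 <= 2 * C by lra.
have C'0 : 0 <= C' by have := tame_ge1 _ N2 C0; rewrite -/C'; lra.
have tC := short_tame ler01 hN1; have tC' := short_tame C0 hN2.
rewrite -!/(tame_const _ _) -/C in tC tC'; rewrite -/C' in tC'.
split.
  have [z [_ _ zl zr]] := short_cone C1 C'0 tC tC'.
  move=> t tad; have /andP[at_ td] : a <= t <= d by move: tad; rewrite in_itv.
  have [tz|zt] := leP t z; [left|right] => u u'.
    by apply: zl; rewrite in_itv/= at_.
  by apply: zr; rewrite in_itv/= td ltW.
move=> u u' uad u'ad; set r := mdist (phi a) (phi d).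
have r0 : 0 <= r by exact: mdist_ge0.
have aad : a \in `[a, d] by rewrite in_itv/= lexx.
have S0 : 0 <= steps_const N3 by rewrite /steps_const !mulr_ge0 ?ltW.
have T'0 : 0 <= T' by rewrite /T' !mulr_ge0 ?ltW.
have CC0 : 0 <= 12 * C * C' by rewrite !mulr_ge0// (le_trans _ C1).
have E0 : 0 <= 2 * (12 * C * C' + 1 + steps_const N3) by lra.
have F0 : 0 <= (1 + H) ^+ n2 * r by rewrite mulr_ge0// ltW.
have G0 : 0 <= 2 * (12 * C * C' + 1 + steps_const N3) * ((T' + 1) * r).
  by apply: mulr_ge0 => //; apply: mulr_ge0 => //; rewrite addr_ge0.
(* Otherwise delta' at phi a is below T' r, hence at phi d below (T' + 1) r, and [short_turning_far]
   applies at the scale S = (T' + 1) r. *)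
have [near|far] := leP (T' * r) (dt a).
  have h1 := short_turning_near hn1 hn2 epsk eps0 near.
  have := metric_triangle (phi u) (phi a) (phi u').
  have := h1 u uad; have := h1 u' u'ad; rewrite (metric_sym (phi u) (phi a)) -/r.
  lra.
have a0 := dt0 aad.
have r1 : 0 < r.
  rewrite lt_neqAle r0 andbT; apply/eqP => e; move: far; rewrite -e mulr0; lra.
have S1 : 0 < (T' + 1) * r by rewrite mulr_gt0//; lra.
have T'r : 0 <= T' * r by rewrite mulr_ge0.
have dS : dt d <= (T' + 1) * r.
  have := bdist_lipschitz bG' (phi d) (phi a); rewrite metric_sym -!/(dt _) -/r.
  lra.
have aS : dt a <= (T' + 1) * r by lra.
have rS : r <= (T' + 1) * r by lra.
have := short_turning_far C1 C'0 tC tC' S1 aS dS rS hN3 uad u'ad.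
rewrite -/(steps_const _); lra.
Qed.

End short_arcs.

End qh_estimate.

End weakly_quasisymmetric_maps.

(** * Choice of the constants and passage to diameters *)

Lemma diam_le (R : realType) (X : metricType R) (A : set X) (l : R) :
  (forall x y, A x -> A y -> mdist x y <= l) -> (diam A <= l%:E)%E.
Proof.
by move=> Al; apply/ereal_supP => _ [[x y] [/= Ax Ay] <-]; rewrite lee_fin Al.
Qed.

Lemma weakly_quasisymmetricW (R : realType) (X Y : metricType R) (H H' : R)
    (G : set X) (f : X -> Y) : H <= H' ->
  weakly_quasisymmetric H G f -> weakly_quasisymmetric H' G f.
Proof.
move=> HH' wf x a b Gx Ga Gb xab; apply: le_trans (wf x a b Gx Ga Gb xab) _.
by rewrite ler_wpM2r// mdist_ge0.
Qed.

Lemma uniform_domainW (R : realType) (X : metricType R) (b b' : R) (G : set X) :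
  boundary G !=set0 -> b <= b' -> uniform_domain b G -> uniform_domain b' G.
Proof.
move=> bG bb' uG x y Gx Gy.
have [t0 [t1 [g [gj rg gm gl]]]] := uG x y Gx Gy.
exists t0, t1, g; split => // [t tt|].
  by apply: le_trans (gm t tt) _; rewrite lee_fin ler_wpM2r// bdist_ge0.
by apply: le_trans gl _; rewrite lee_fin ler_wpM2r// mdist_ge0.
Qed.

Theorem theorem2 (R : realType) (c H b : R) (hc : 1 <= c) :
  exists lambda1 lambda2 : R,
  forall (X Y : completeMetricType R)
    (hX : quasiconvex X c) (hY : quasiconvex Y c)
    (G : set X) (G' : set Y)
    (hG : domain G) (hGX : G != setT) (hG' : domain G') (hG'Y : G' != setT)
    (f : X -> Y) (hf : homeomorphism_on G G' f)
    (hfH : weakly_quasisymmetric H G f)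
    (hb : uniform_domain b G')
    (eps : R) (x y : X) (t0 t1 : R) (g : R -> X)
    (hg : short_arc G eps t0 t1 g x y)
    (heps0 : 0 < eps)
    (heps : (eps%:E < mine 1 (qh_dist G x y * (6^-1)%:E))%E),
    (forall t, t \in `[t0, t1] ->
      (mine (diam ((f \o g) @` `[t0, t])) (diam ((f \o g) @` `[t, t1]))
         <= (lambda1 * bdist G' (f (g t)))%:E)%E)
    /\ (diam ((f \o g) @` `[t0, t1]) <= (lambda2 * mdist (f x) (f y))%:E)%E.
Proof.
(* The estimates are stated for constants at least 1, and both conditions on the map and the domain
   persist when their constant grows. *)
pose H' := Num.max H 1; pose b' := Num.max b 1.
have H1 : 1 <= H' by rewrite le_max lexx orbT.
have b1 : 1 <= b' by rewrite le_max lexx orbT.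
have c0 : 0 < c by exact: lt_le_trans hc.
have H0 : 0 < H' by exact: lt_le_trans H1.
have b0 : 0 < b' by exact: lt_le_trans b1.
have nat_above (z : R) : exists n : nat, z <= n%:R.
  by have [n] := natr_bound z ltr01; rewrite mulr1; exists n.
have [n0 hn0] := nat_above (16 * c ^+ 2).
have [M hM] := nat_above (5 * c).
have [n1 hn1] := nat_above (112 * c ^+ 3).
have [n2 hn2] := nat_above (8 * c ^+ 2).
(* These repeat the local definitions of the preceding sections, so that the hypotheses of
   [short_image] hold by conversion; they are built from c, H' and b' before any space is
   introduced. *)
pose T := 4 * c * H' * (1 + H') ^+ n0; pose tau := (b' * T)^-1.
pose K := 3 * H'; pose steps N := (M * (2 * N + 3)).+1.
pose tame_const A N := 2 * ((steps N)%:R * (K * A)) + (1 + K) ^+ steps N.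
have K0 : 0 < K by rewrite mulr_gt0.
have tau0 : 0 < tau.
  by rewrite invr_gt0 !mulr_gt0// exprn_gt0// addr_gt0.
have tame_ge0 A N : 0 <= A -> 0 <= tame_const A N.
  move=> A0; rewrite addr_ge0 ?exprn_ge0 ?addr_ge0 ?(ltW K0)//.
  by rewrite !mulr_ge0// ltW.
have exN A : 0 <= A -> exists N : nat, forall n, (N <= n)%N ->
    b' * ((steps n.+1)%:R * (K * A)) <= (1 + tau) ^+ n * tau.
  move=> A0; have B0 : 0 <= b' * (K * A) by rewrite !mulr_ge0// ltW.
  (* [steps n.+1] equals 2 M n + (5 M + 1), which is where the slope and the constant term come
     from. *)
  have P0 : 0 <= b' * (K * A) * (2 * M%:R) by rewrite mulr_ge0// mulr_ge0.
  have Q0 : 0 <= b' * (K * A) * (5 * M%:R + 1).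
    by rewrite mulr_ge0// addr_ge0// mulr_ge0.
  have [N NP] := linear_le_geometric tau0 P0 Q0.
  exists N => n /NP; apply: le_trans; rewrite le_eqVlt; apply/orP; left.
  have -> : (steps n.+1)%:R = M%:R * (2 * n%:R + 5) + 1 :> R.
    rewrite /steps -natr1 natrM; congr (_ * _ + _).
    by rewrite natrD natrM -natr1; ring.
  by apply/eqP; ring.
have [N1 hN1] := exN 1 ler01.
set C := tame_const 1 N1.
have C0 : 0 <= 2 * C by rewrite mulr_ge0// tame_ge0.
have [N2 hN2] := exN (2 * C) C0.
set C' := tame_const (2 * C) N2.
have [N3 hN3] : exists N, b' * (8 * C * C' + 1) <= (1 + tau) ^+ N * tau.
  have Q0 : 0 <= b' * (8 * C * C' + 1).
    rewrite mulr_ge0 ?(ltW b0)// addr_ge0// !mulr_ge0//; exact: tame_ge0.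
  have [N /(_ N (leqnn N))] := linear_le_geometric tau0 (lexx 0) Q0.
  by rewrite mul0r add0r; exists N.
pose steps_const N := (steps N)%:R * (K * (1 + K) ^+ steps N).
pose T' := 4 * c * H' * (1 + H') ^+ n1.
exists (4 * C * C'), (2 * (1 + H') ^+ n2 +
  2 * (12 * C * C' + 1 + steps_const N3) * (T' + 1)).
move=> X Y hX hY G G' hG hGX hG' hG'Y f [[fG _ fS] cf [h ch fK]] hfH hb.
move=> eps x y t0 t1 g hg heps0; rewrite lt_min => /andP[eps1 epsk].
have wf : weakly_quasisymmetric H' G f.
  by apply: weakly_quasisymmetricW hfH; rewrite le_max lexx.
have uG' : uniform_domain b' G'.
  apply: uniform_domainW hb; last by rewrite le_max lexx.
  exact: boundary_neq0 hY hG' hG'Y.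
have {}fS y' : G' y' -> exists2 x', G x' & f x' = y'.
  by move=> /fS[x' Gx' fx']; exists x'.
have {}fG x' : G x' -> G' (f x') by move=> Gx'; exact: fG.
have {}eps1 : eps < 1 by move: eps1; rewrite lte_fin.
have [fx fy] : f x = (f \o g) t0 /\ f y = (f \o g) t1.
  by case: hg => -[_ <- <-].
have [cone turning] := short_image hc H1 b1 hX hY hG hGX hG' hG'Y fG fS fK cf ch
  wf uG' hn0 hM hg eps1 hN1 hN2 hN3 hn1 hn2 epsk heps0.
split; last first.
  rewrite fx fy; apply: diam_le => _ _ [u /= uab <-] [v /= vab <-].
  exact: turning.
move=> t tab; rewrite ge_min; apply/orP.
by case: (cone t tab) => le_u; [left|right];
  apply: diam_le => _ _ [u /= uab <-] [v /= vab <-]; exact: le_u.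
Qed.
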